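(* Let $(X,d)$ be a finite metric space and let $Y\subset X$ be a $\delta$-approximation of $X$. Then: (i) The persistence modules $(M^{\mathcal{R}}(Y),M^{\mathcal{R}}(X))$ are $(\tau,\sigma)$-interleaved, where $\tau(t)=t$ and $\sigma(t)=t+\delta$. (ii) There exists a matching $\mathcal{X}\colon\mathsf{PD}(M^{\mathcal{R}}(Y))\nrightarrow\mathsf{PD}(M^{\mathcal{R}}(X))$ such that if $\mathcal{X}([b,d,i])=[b',d',i']$, then $b-\delta\le b'\le b$ and $d-\delta\le d'\le d$. Moreover, all unmatched points in $\mathsf{PD}(M^{\mathcal{R}}(Y))$ and $\mathsf{PD}(M^{\mathcal{R}}(X))$ are at most $\delta$ above the diagonal (i.e. an unmatched point $[b,d,i]$ satisfies $d\le b+\delta$).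
   Context: Fix a field $\mathsf{k}$; $\overline{\mathbb{R}}=\mathbb{R}\cup\{\pm\infty\}$. A persistence module $V=(V,\varphi_V)$ is a family of $\mathsf{k}$-vector spaces $\{V_t\}_{t\in\mathbb{R}}$ with linear maps $\varphi_V(s,t)\colon V_s\to V_t$ for $s\le t$ such that $\varphi_V(t,t)=\mathrm{id}$ and $\varphi_V(s,t)\circ\varphi_V(r,s)=\varphi_V(r,t)$ for $r\le s\le t$. It is PFD if every $V_t$ is finite-dimensional. A morphism $\phi\colon V\to W$ is a family of linear maps $\phi_t\colon V_t\to W_t$ with $\phi_t\circ\varphi_V(s,t)=\varphi_W(s,t)\circ\phi_s$ for $s\le t$. A subset $Y\subset X$ (with the restricted metric) is a $\delta$-approximation of $X$ ($\delta\ge0$) if for every $x\in X$ there is $y\in Y$ with $d(x,y)\le\delta$. For a finite metric space $X$ and $t\in\mathbb{R}$, the Vietoris–Rips complex $\mathcal{R}(X,t)$ is the simplicial complex on vertex set $X$ containing the $N$-simplex $[x_{i_0},\dots,x_{i_N}]$ if and only if $d(x_{i_j},x_{i_k})\le2t$ for all $j,k=0,\dots,N$ (the condition is applied also with $j=k$, so $\mathcal{R}(X,t)=\emptyset$ for $t<0$). $M^{\mathcal{R}}(X)$ is the PFD persistence module $M^{\mathcal{R}}(X)_t=H_*(\mathcal{R}(X,t),\mathsf{k})$ (simplicial homology) with transition maps induced by the inclusions $\mathcal{R}(X,t)\subseteq\mathcal{R}(X,s)$, $t\le s$. Interleavings: a translation map is a monotone (non-decreasing) $\sigma\colon\mathbb{R}\to\mathbb{R}$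 with $x\le\sigma(x)$ for all $x$. A translation pair is a pair $(\tau,\sigma)$ of monotone functions $\mathbb{R}\to\mathbb{R}$ such that $\tau\circ\sigma$ and $\sigma\circ\tau$ are translation maps. For $\sigma$ monotone, $V(\sigma)_t=V_{\sigma(t)}$ with $\varphi_{V(\sigma)}(s,t)=\varphi_V(\sigma(s),\sigma(t))$; for a morphism $\phi$, $\phi(\sigma)_t=\phi_{\sigma(t)}$. For a translation pair $(\tau,\sigma)$, an ordered pair $(V,W)$ is $(\tau,\sigma)$-interleaved if there are morphisms $\phi\colon V\to W(\tau)$, $\psi\colon W\to V(\sigma)$ with $\psi(\tau)_t\circ\phi_t=\varphi_V(t,(\sigma\circ\tau)(t))$ and $\phi(\sigma)_t\circ\psi_t=\varphi_W(t,(\tau\circ\sigma)(t))$ for all $t\in\mathbb{R}$. Undecorated persistence diagram: every PFD persistence module $V$ is a direct sum of interval modules $I_J$ ($J\subseteq\mathbb{R}$ a nonempty interval; $\mathsf{k}$ on $J$, $0$ elsewhere, identity maps within $J$), uniquely up to reindexing. $\mathsf{PD}(V)\subset\overline{\mathbb{R}}^2\times\mathbb{N}_{>0}$ is a set of points $[b,d,i]$ in bijection with the interval summands of $V$ (counted with multiplicity), where a summand $I_J$ corresponds to a point with $b=\inf J$, $d=\sup J$ (the index $i$ distinguishes points with equal $(b,d)$). A matching $\mathcal{X}\colon S\nrightarrow T$ is a relation that is the graph of an injective function $S'\to T'$, $S'\subseteq S$, $T'\subseteq T$; $\mathcal{X}(s)=t$ means $(s,t)\in\mathcal{X}$; points outside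 the domain/image of this function are unmatched. *)

(* Defs.v *)
From HB Require Import structures.
From mathcomp Require Import all_boot all_order all_algebra generic_quotient.
From mathcomp Require Import ring_quotient.
From mathcomp Require Import boolp classical_sets functions cardinality.
From mathcomp Require Import set_interval reals constructive_ereal ereal.
From mathcomp Require Import topology.

Set Implicit Arguments.
Unset Strict Implicit.
Unset Printing Implicit Defensive.

Import Order.TTheory GRing.Theory Num.Theory.

Local Open Scope classical_set_scope.
Local Open Scope quotient_scope.
Local Open Scope ring_scope.

(** ** Quotients of vector spaces

    [vquot Z B] is Z / (Z :&: B), for subspaces Z and B of a common ambient
    space; homology uses it with B <= Z. *)

Section VQuot.
Context (k : fieldType) (vT : vectType k) (Z B : {vspace vT}).

Definition vquot_pred : {pred subvs_of Z} := fun z => vsval z \in B.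

Lemma in_vquot_pred (z : subvs_of Z) : (z \in vquot_pred) = (vsval z \in B).
Proof. by []. Qed.

Fact vquot_pred_zmod_closed : zmod_closed vquot_pred.
Proof.
split=> [|x y]; rewrite !in_vquot_pred ?raddf0 ?mem0v//.
by move=> xB yB; rewrite raddfB rpredB.
Qed.

HB.instance Definition _ :=
  GRing.isZmodClosed.Build (subvs_of Z) vquot_pred vquot_pred_zmod_closed.

Definition vquot : Type := Quotient.quot vquot_pred.

HB.instance Definition _ := EqQuotient.on vquot.
HB.instance Definition _ := GRing.Zmodule.on vquot.
HB.instance Definition _ := ZmodQuotient.on vquot.

Lemma vquot_eqE (x y : subvs_of Z) :
  (\pi_vquot x == \pi_vquot y) = (vsval x - vsval y \in B).
Proof. by rewrite -Quotient.idealrBE in_vquot_pred raddfB. Qed.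

Lemma repr_vquotP (x : subvs_of Z) :
  vsval (repr (\pi_vquot x)) - vsval x \in B.
Proof. by rewrite -vquot_eqE reprK. Qed.

Definition vquot_scale (a : k) (q : vquot) : vquot := \pi_vquot (a *: repr q).

Lemma pi_vquot_scale a (x : subvs_of Z) :
  vquot_scale a (\pi_vquot x) = \pi_vquot (a *: x).
Proof.
apply/eqP; rewrite vquot_eqE.
have vsvalZ (u : subvs_of Z) : vsval (a *: u) = a *: vsval u by [].
by rewrite !vsvalZ -scalerBr memvZ ?repr_vquotP.
Qed.

Lemma pi_vquotD (x y : subvs_of Z) :
  \pi_vquot (x + y) = \pi_vquot x + \pi_vquot y.
Proof. by rewrite raddfD. Qed.

Fact vquot_scaleA a b q :
  vquot_scale a (vquot_scale b q) = vquot_scale (a * b) q.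
Proof.
elim/quotW: q => x.
by rewrite (pi_vquot_scale b x) !pi_vquot_scale (scalerA a b (x : subvs_of Z)).
Qed.

Fact vquot_scale1 : left_id 1 vquot_scale.
Proof. by elim/quotW=> x; rewrite pi_vquot_scale (scale1r (x : subvs_of Z)). Qed.

Fact vquot_scaleDr : right_distributive vquot_scale +%R.
Proof.
move=> a; elim/quotW=> x; elim/quotW=> y.
by rewrite -pi_vquotD !pi_vquot_scale scalerDr pi_vquotD.
Qed.

Fact vquot_scaleDl q : {morph vquot_scale^~ q : a b / a + b}.
Proof.
elim/quotW: q => x a b.
by rewrite !pi_vquot_scale scalerDl pi_vquotD.
Qed.

HB.instance Definition _ := GRing.Zmodule_isLmodule.Build k vquot
  vquot_scaleA vquot_scale1 vquot_scaleDr vquot_scaleDl.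

Lemma pi_vquotZ a (x : subvs_of Z) :
  \pi_vquot (a *: x) = a *: (\pi_vquot x : vquot).
Proof. by rewrite -pi_vquot_scale. Qed.

End VQuot.

Section VQuotIncl.
Context (k : fieldType) (vT : vectType k) (Z B Z' B' : {vspace vT}).
Hypotheses (ZZ' : (Z <= Z')%VS) (BB' : (B <= B')%VS).

Definition vquot_incl of (Z <= Z')%VS & (B <= B')%VS :=
  fun q : vquot Z B => \pi_(vquot Z' B') (vsproj Z' (vsval (repr q))).

Local Notation incl := (vquot_incl ZZ' BB').

Lemma vquot_incl_pi (x : subvs_of Z) :
  incl (\pi_(vquot Z B) x) = \pi_(vquot Z' B') (vsproj Z' (vsval x)).
Proof.
apply/eqP; rewrite vquot_eqE !vsprojK; try exact: (subvP ZZ' _ (subvsP _)).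
exact: (subvP BB' _ (repr_vquotP _ _)).
Qed.

Fact vquot_incl_linear : linear incl.
Proof.
move=> a; elim/quotW=> x; elim/quotW=> y.
rewrite -pi_vquotZ -pi_vquotD !vquot_incl_pi.
by rewrite -pi_vquotZ -pi_vquotD !linearP.
Qed.

HB.instance Definition _ :=
  GRing.isLinear.Build k (vquot Z B) (vquot Z' B') _ incl vquot_incl_linear.

End VQuotIncl.

(** ** Direct sums of families of vector spaces *)

Section DirectSum.
Context (k : fieldType) (I : Type) (V : I -> lmodType k).

Record dsum := DSum {
  dsum_fun :> forall i, V i;
  dsum_finite : finite_set [set i | dsum_fun i != 0] }.

HB.instance Definition _ := gen_eqMixin dsum.
HB.instance Definition _ := gen_choiceMixin dsum.

Lemma dsumP (f g : dsum) : (forall i, f i = g i) -> f = g.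
Proof.
case: f g => [f fP] [g gP] /= fg.
have E : f = g by apply: functional_extensionality_dep.
by subst g; congr DSum; exact: Prop_irrelevance.
Qed.

Fact dsum0_finite : finite_set [set i : I | (0 : V i) != 0].
Proof.
by apply: (sub_finite_set _ (finite_set0 I)) => i /=; rewrite eqxx.
Qed.
Definition dsum0 := DSum dsum0_finite.

Fact dsumN_finite (f : dsum) : finite_set [set i | - f i != 0].
Proof.
by apply: (sub_finite_set _ (dsum_finite f)) => i /=; rewrite oppr_eq0.
Qed.
Definition dsumN f := DSum (dsumN_finite f).

Fact dsumD_finite (f g : dsum) : finite_set [set i | f i + g i != 0].
Proof.
apply: (@sub_finite_set _ _ ([set i | f i != 0] `|` [set i | g i != 0])).
  move=> i /=; case: (eqVneq (f i) 0) => [->|]; last by left.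
  by rewrite add0r; right.
by rewrite finite_setU; split; apply: dsum_finite.
Qed.
Definition dsumD f g := DSum (dsumD_finite f g).

Fact dsumZ_finite a (f : dsum) : finite_set [set i | a *: f i != 0].
Proof.
apply: (sub_finite_set _ (dsum_finite f)) => i /=.
by rewrite scaler_eq0 => /norP[].
Qed.
Definition dsumZ a f := DSum (dsumZ_finite a f).

Fact dsumA : associative dsumD.
Proof. by move=> f g h; apply: dsumP => i /=; rewrite addrA. Qed.
Fact dsumC : commutative dsumD.
Proof. by move=> f g; apply: dsumP => i /=; rewrite addrC. Qed.
Fact dsum0D : left_id dsum0 dsumD.
Proof. by move=> f; apply: dsumP => i /=; rewrite add0r. Qed.
Fact dsumND : left_inverse dsum0 dsumN dsumD.
Proof. by move=> f; apply: dsumP => i /=; rewrite addNr. Qed.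

HB.instance Definition _ :=
  GRing.isZmodule.Build dsum dsumA dsumC dsum0D dsumND.

Fact dsumZA a b f : dsumZ a (dsumZ b f) = dsumZ (a * b) f.
Proof. by apply: dsumP => i /=; rewrite scalerA. Qed.
Fact dsumZ1 : left_id 1 dsumZ.
Proof. by move=> f; apply: dsumP => i /=; rewrite scale1r. Qed.
Fact dsumZDr : right_distributive dsumZ +%R.
Proof. by move=> a f g; apply: dsumP => i /=; rewrite scalerDr. Qed.
Fact dsumZDl f : {morph dsumZ^~ f : a b / a + b}.
Proof. by move=> a b; apply: dsumP => i /=; rewrite scalerDl. Qed.

HB.instance Definition _ := GRing.Zmodule_isLmodule.Build k dsum
  dsumZA dsumZ1 dsumZDr dsumZDl.

End DirectSum.

Section DirectSumMap.
Context (k : fieldType) (I : Type) (V W : I -> lmodType k).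
Variable f : forall i, {linear V i -> W i}.

Fact dsum_map_finite (v : dsum V) : finite_set [set i | f i (v i) != 0].
Proof.
apply: (sub_finite_set _ (dsum_finite v)) => i /=.
by apply: contra_neq => ->; rewrite raddf0.
Qed.

Definition dsum_map (v : dsum V) : dsum W := DSum (dsum_map_finite v).

Fact dsum_map_linear : linear dsum_map.
Proof. by move=> a u v; apply: dsumP => i /=; rewrite linearP. Qed.

HB.instance Definition _ :=
  GRing.isLinear.Build k (dsum V) (dsum W) _ dsum_map dsum_map_linear.

End DirectSumMap.

(** ** Persistence modules *)

Record persmod (k : fieldType) (R : realType) := PersMod {
  pm_space :> R -> lmodType k;
  pm_map : forall s t : R, s <= t -> {linear pm_space s -> pm_space t};
  pm_map_id : forall (t : R) (tt : t <= t) v, pm_map tt v = v;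
  pm_map_comp : forall (r s t : R) (rs : r <= s) (st : s <= t) (rt : r <= t) v,
    pm_map st (pm_map rs v) = pm_map rt v }.

Arguments pm_map {k R} p {s t}.

Record pm_hom (k : fieldType) (R : realType) (V W : persmod k R) := PMHom {
  pm_hom_fun :> forall t, {linear V t -> W t};
  pm_hom_natural : forall (s t : R) (st : s <= t) v,
    pm_hom_fun t (pm_map V st v) = pm_map W st (pm_hom_fun s v) }.

Definition pm_isomorphic (k : fieldType) (R : realType) (V W : persmod k R) :=
  exists phi : pm_hom V W, forall t, bijective (phi t).

Section PersistenceDirectSum.
Context (k : fieldType) (R : realType) (I : Type) (V : I -> persmod k R).

Definition pm_dsum_map (s t : R) (st : s <= t) :
    {linear dsum (fun i => V i s) -> dsum (fun i => V i t)} :=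
  dsum_map (fun i => pm_map (V i) st).

Fact pm_dsum_map_id (t : R) (tt : t <= t) v : pm_dsum_map tt v = v.
Proof. by apply: dsumP => i /=; rewrite pm_map_id. Qed.

Fact pm_dsum_map_comp (r s t : R) (rs : r <= s) (st : s <= t) (rt : r <= t) v :
  pm_dsum_map st (pm_dsum_map rs v) = pm_dsum_map rt v.
Proof. by apply: dsumP => i /=; rewrite (pm_map_comp _ _ rt). Qed.

Definition pm_dsum : persmod k R :=
  PersMod pm_dsum_map_id pm_dsum_map_comp.

End PersistenceDirectSum.

Section IntervalModule.
Context (k : fieldType) (R : realType) (J : interval R).

Definition itv_space (t : R) : {vspace k^o} :=
  if t \in J then fullv else 0%VS.

(* The projection of k onto [itv_space t] is the identity when t is in J and
   zero otherwise. *)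
Definition itv_map (s t : R) (st : s <= t) :
    {linear subvs_of (itv_space s) -> subvs_of (itv_space t)} :=
  vsproj (itv_space t) \o vsval.

Fact itv_map_id (t : R) (tt : t <= t) v : itv_map tt v = v.
Proof. exact: vsvalK. Qed.

Fact itv_space0 (t : R) (v : subvs_of (itv_space t)) :
  t \notin J -> vsval v = 0.
Proof.
move=> tJ; apply/eqP; rewrite -memv0.
by have := subvsP v; rewrite [in X in _ \in X]/itv_space (negPf tJ).
Qed.

Fact itv_map_comp (r s t : R) (rs : r <= s) (st : s <= t) (rt : r <= t) v :
  itv_map st (itv_map rs v) = itv_map rt v.
Proof.
case: (boolP (t \in J)) => tJ; last first.
  by apply: (can_inj (@vsvalK _ _ _)); rewrite !itv_space0.
case: (boolP (r \in J)) => rJ; last first.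
  by rewrite /= (itv_space0 v rJ) !linear0.
have sJ : s \in J.
  have /subitvP : (`[r, t] <= J)%O; last by apply; rewrite in_itv /= rs st.
  case: (J) rJ tJ => [a b]; rewrite subitvE !itv_boundlr.
  by move=> /andP[-> _] /andP[_ ->].
have itv_spaceT : itv_space s = fullv by rewrite /itv_space sJ.
by congr vsproj; apply: vsprojK; rewrite itv_spaceT memvf.
Qed.

Definition itv_module : persmod k R := PersMod itv_map_id itv_map_comp.

End IntervalModule.

(** ** Interleavings *)

Section Interleaving.
Context (k : fieldType) (R : realType).

Definition translation_map (sigma : R -> R) :=
  {homo sigma : x y / x <= y} /\ forall x, x <= sigma x.

Record translation_pair (tau sigma : R -> R) : Prop := TranslationPair {
  tp_homol : {homo tau : x y / x <= y};
  tp_homor : {homo sigma : x y / x <= y};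
  tp_transl : translation_map (tau \o sigma);
  tp_transr : translation_map (sigma \o tau) }.

Definition pm_shift (V : persmod k R) (sigma : R -> R)
    (hsigma : {homo sigma : x y / x <= y}) : persmod k R :=
  @PersMod k R (fun t => V (sigma t))
    (fun s t st => pm_map V (hsigma s t st))
    (fun t tt v => pm_map_id (hsigma t t tt) v)
    (fun r s t rs st rt v =>
       pm_map_comp (hsigma r s rs) (hsigma s t st) (hsigma r t rt) v).

Definition interleaved (tau sigma : R -> R) (V W : persmod k R) : Prop :=
  exists H : translation_pair tau sigma,
  exists phi : pm_hom V (pm_shift W (tp_homol H)),
  exists psi : pm_hom W (pm_shift V (tp_homor H)),
    (forall t (v : V t),
      psi (tau t) (phi t v) = pm_map V ((tp_transr H).2 t) v) /\
    (forall t (w : W t),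
      phi (sigma t) (psi t w) = pm_map W ((tp_transl H).2 t) w).

End Interleaving.

(** ** Persistence diagrams and matchings *)

(* The point [b, d, i] of a diagram is the triple (b, d, i). *)
Definition dgm_point (R : realType) : Type := (\bar R * \bar R * nat)%type.

(* D is one of the sets of points that may serve as PD(V): the labels i are only
   required to be positive and to separate equal intervals. *)
Definition persistence_diagram (k : fieldType) (R : realType)
    (V : persmod k R) (D : set (dgm_point R)) : Prop :=
  exists (I : Type) (J : I -> interval R) (p : I -> dgm_point R),
    [/\ forall i, [set` J i] !=set0,
        pm_isomorphic V (pm_dsum (fun i => itv_module k (J i))),
        set_bij [set: I] D p &
        forall i, [/\ (p i).1.1 = ereal_inf (EFin @` [set` J i]),
                      (p i).1.2 = ereal_sup (EFin @` [set` J i]) &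
                      (0 < (p i).2)%N]].

Section Matching.
Context (S0 T0 : Type).

Definition matching (S : set S0) (T : set T0) (chi : set (S0 * T0)) : Prop :=
  exists (S' : set S0) (T' : set T0) (f : S0 -> T0),
    [/\ S' `<=` S, T' `<=` T, set_fun S' T' f, set_inj S' f &
        chi = [set (s, f s) | s in S']].

Definition unmatched_left (S : set S0) (chi : set (S0 * T0)) : set S0 :=
  [set s | S s /\ forall t, ~ chi (s, t)].

Definition unmatched_right (T : set T0) (chi : set (S0 * T0)) : set T0 :=
  [set t | T t /\ forall s, ~ chi (s, t)].

End Matching.

(** ** Simplicial homology

    A simplicial complex on a finite vertex type V is the set K of its
    simplices, which are nonempty sets of vertices. All chains live in the free
    vector space on {set V}. *)

Section Homology.
Context (k : fieldType) (V : finType).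

Local Notation chain := {ffun {set V} -> k^o}.

Definition simplex_chain (s : {set V}) : chain :=
  [ffun s' => (s' == s)%:R].

(* The position of v among the vertices of s, for the order of [enum V]. *)
Definition vertex_pos (s : {set V}) (v : V) : nat :=
  #|[pred u in s | (enum_rank u < enum_rank v)%N]|.

(* The condition [s :\ v != set0] makes the boundary of a vertex zero. *)
Definition simplex_boundary (s : {set V}) : chain :=
  \sum_(v in s | s :\ v != finset.set0)
    (-1) ^+ vertex_pos s v *: simplex_chain (s :\ v).

Definition boundary (c : chain) : chain :=
  \sum_(s : {set V}) c s *: simplex_boundary s.

Fact boundary_linear : linear boundary.
Proof.
move=> a c c'; rewrite /boundary scaler_sumr -big_split/=.
by apply: eq_bigr => s _; rewrite !ffunE scalerDl scalerA.
Qed.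

HB.instance Definition _ :=
  GRing.isLinear.Build k chain chain _ boundary boundary_linear.

Lemma boundary_simplex (s : {set V}) :
  boundary (simplex_chain s) = simplex_boundary s.
Proof.
rewrite /boundary (bigD1 s) //= big1 => [|s' /negPf s's].
  by rewrite addr0 ffunE eqxx scale1r.
by rewrite ffunE s's scale0r.
Qed.

Lemma vertex_posD1 (s : {set V}) (u v : V) : u \in s ->
  vertex_pos s v = ((enum_rank u < enum_rank v) + vertex_pos (s :\ u) v)%N.
Proof.
move=> us; rewrite /vertex_pos [LHS](cardD1 u) [u \in _]inE us /=; congr (_ + _)%N.
by apply: eq_card => w; rewrite !inE andbA.
Qed.

Lemma boundary_simplex_boundary (s : {set V}) :
  boundary (simplex_boundary s) = 0.
Proof.
rewrite /simplex_boundary linear_sum /=.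
under eq_bigr => v _ do rewrite linearZ /= boundary_simplex.
have E (v : V) : v \in s -> s :\ v != finset.set0 ->
  (-1) ^+ vertex_pos s v *: simplex_boundary (s :\ v) =
  \sum_(u in s | (u != v) && (s :\ v :\ u != finset.set0))
   (-1) ^+ (vertex_pos s v + vertex_pos (s :\ v) u) *: simplex_chain (s :\ v :\ u).
  move=> vs _; rewrite /simplex_boundary scaler_sumr.
  apply: eq_big => [u|u]; first by rewrite !inE -andbA; case: (u \in s); rewrite ?andbF ?andbT.
  by rewrite scalerA exprD.
rewrite (eq_bigr _ (fun v h => E v (proj1 (andP h)) (proj2 (andP h)))).
pose F v u := (-1) ^+ (vertex_pos s v + vertex_pos (s :\ v) u) *: simplex_chain (s :\ v :\ u).
pose P v u := (u != v) && (s :\ v :\ u != finset.set0).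
have dropP v : v \in s -> (\sum_(u in s | P v u) F v u) =
  if s :\ v != finset.set0 then \sum_(u in s | P v u) F v u else 0.
  move=> _; case: ifPn => // /negPn /eqP e; apply: big1 => u.
  by rewrite /P e finset.set0D eqxx !andbF.
rewrite big_mkcondr /= -(eq_bigr _ dropP).
have Fanti v u : v \in s -> u \in s -> u != v -> F v u = - F u v.
  move=> vs us uv; rewrite /F finset.setDDl finset.setUC -finset.setDDl -scaleNr; congr (_ *: _).
  rewrite (vertex_posD1 v us) (vertex_posD1 u vs).
  have : enum_rank u != enum_rank v by rewrite (inj_eq enum_rank_inj).
  case: (ltngtP (enum_rank u) (enum_rank v)) => [_ _|_ _|/val_inj->]; last by rewrite eqxx.
  - by rewrite add1n add0n addSn exprS mulN1r addnC.
  - by rewrite add1n add0n addSn exprS mulN1r opprK addnC.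
have Psym v u : P v u = P u v.
  by rewrite /P eq_sym finset.setDDl finset.setUC -finset.setDDl.
rewrite pair_big_dep /= (bigID (fun p => (enum_rank p.1 < enum_rank p.2)%N)) /=.
rewrite [X in _ + X](reindex_inj (h := fun p => (p.2, p.1))) /=; last by move=> [? ?] [? ?] [-> ->].
apply/eqP; rewrite addr_eq0; apply/eqP; rewrite -sumrN.
apply: eq_big => [[v u]|[v u]] /=.
  rewrite Psym -leqNgt; case: (v \in s); case: (u \in s) => //=.
  rewrite /P; case: (eqVneq v u) => //= vu; congr andb.
  by rewrite [RHS]leq_eqVlt (inj_eq val_inj) (inj_eq enum_rank_inj) (negPf vu).
by move=> /andP[/and3P[vs us /andP[uv _]] _]; exact: Fanti.
Qed.

Lemma boundaryK (c : chain) : boundary (boundary c) = 0.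
Proof.
rewrite [X in boundary X]/boundary linear_sum big1// => s _.
by rewrite linearZ /= boundary_simplex_boundary scaler0.
Qed.

Definition chains (K : {set {set V}}) (n : nat) : {vspace chain} :=
  <<[seq simplex_chain s | s : {set V} <- enum K & #|s| == n.+1]>>%VS.

Definition cycles K n : {vspace chain} :=
  (chains K n :&: lker (linfun boundary))%VS.

Definition boundaries K n : {vspace chain} :=
  (linfun boundary @: chains K n.+1)%VS.

Lemma boundaries_cycles (K : {set {set V}}) n :
  (forall s v, s \in K -> v \in s -> s :\ v != finset.set0 -> s :\ v \in K) ->
  (boundaries K n <= cycles K n)%VS.
Proof.
move=> Kface; rewrite subv_cap; apply/andP; split; last first.
  apply/subvP => _ /memv_imgP[c _ ->].
  by rewrite memv_ker !lfunE /= boundaryK.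
rewrite /boundaries limg_span; apply/span_subvP => _ /mapP[_ /mapP[s + ->] ->].
rewrite mem_filter mem_enum lfunE /= boundary_simplex => /andP[/eqP sn sK].
apply: memv_suml => v /andP[vs s0]; apply/memvZ/memv_span/map_f.
rewrite mem_filter mem_enum Kface// andbT.
by have := cardsD1 v s; rewrite vs sn add1n => -[->].
Qed.

Definition homology K n : lmodType k := vquot (cycles K n) (boundaries K n).

Section Inclusion.
Variables (K L : {set {set V}}) (n : nat).
Hypothesis KL : K \subset L.

Fact chains_sub m : (chains K m <= chains L m)%VS.
Proof.
apply: sub_span => c /mapP[s]; rewrite mem_filter mem_enum => /andP[sm sK] ->.
by apply: map_f; rewrite mem_filter sm mem_enum (fintype.subsetP KL).
Qed.

Fact cycles_sub : (cycles K n <= cycles L n)%VS.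
Proof. exact: capvS (chains_sub n) (subvv _). Qed.

Fact boundaries_sub : (boundaries K n <= boundaries L n)%VS.
Proof. exact: limgS (chains_sub n.+1). Qed.

Definition homology_incl : {linear homology K n -> homology L n} :=
  vquot_incl cycles_sub boundaries_sub.

End Inclusion.

Lemma homology_incl_id (K : {set {set V}}) n (KK : K \subset K) (h : homology K n) :
  homology_incl n KK h = h.
Proof. by elim/quotW: h => x; rewrite /= vquot_incl_pi vsvalK. Qed.

Lemma homology_incl_comp (K L M : {set {set V}}) n
    (KL : K \subset L) (LM : L \subset M) (KM : K \subset M)
    (h : homology K n) :
  homology_incl n LM (homology_incl n KL h) = homology_incl n KM h.
Proof.
elim/quotW: h => x.
rewrite /= (vquot_incl_pi _ _ (x : subvs_of (cycles K n))) !vquot_incl_pi.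
by rewrite vsprojK // (subvP (cycles_sub n KL)) // subvsP.
Qed.

End Homology.

(** ** Vietoris-Rips filtrations of finite metric spaces *)

#[short(type="finMetricType")]
HB.structure Definition FinMetric (R : numDomainType) :=
  { X of Metric R X & Finite X }.

Section VietorisRips.
Context (R : realType) (X : finMetricType R).

Definition approximation (delta : R) (Y : {set X}) : Prop :=
  forall x : X, exists2 y, y \in Y & mdist x y <= delta.

(* The complex of the subspace A, with the restricted metric; that of X itself
   is the case A = [set: X]. *)
Definition rips (A : {set X}) (t : R) : {set {set X}} :=
  [set s : {set X} | [&& s != finset.set0, s \subset A &
    [forall x in s, forall y in s, mdist x y <= 2 * t]]]%SET.

Lemma rips_sub (A : {set X}) (s t : R) : s <= t -> rips A s \subset rips A t.
Proof.
move=> st; apply/fintype.subsetP => a; rewrite !inE => /and3P[-> -> /= h].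
apply/forall_inP => x xa; apply/forall_inP => y ya.
have /forall_inP/(_ _ ya) := forall_inP h x xa.
by move=> /le_trans; apply; rewrite ler_pM2l.
Qed.

Lemma rips_face (A : {set X}) (t : R) (s : {set X}) (v : X) :
  s \in rips A t -> v \in s -> s :\ v != finset.set0 -> s :\ v \in rips A t.
Proof.
rewrite !inE => /and3P[_ sA /forall_inP h] vs -> /=.
rewrite (fintype.subset_trans _ sA) ?subD1set//=.
apply/forall_inP => x; rewrite !inE => /andP[_ xs].
by apply/forall_inP => y; rewrite !inE => /andP[_ ys]; exact: (forall_inP (h x xs)).
Qed.

Context (k : fieldType).

Definition rips_homology (A : {set X}) (n : nat) : persmod k R :=
  @PersMod k R (fun t => homology k (rips A t) n)
    (fun s t st => homology_incl k n (rips_sub A st))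
    (fun t tt h => homology_incl_id (rips_sub A tt) h)
    (fun r s t rs st rt h =>
       homology_incl_comp (rips_sub A rs) (rips_sub A st) (rips_sub A rt) h).

Definition rips_module (A : {set X}) : persmod k R :=
  pm_dsum (rips_homology A).

End VietorisRips.

(* Main.v *)
Require Import Defs.
From HB Require Import structures.
From mathcomp Require Import all_boot all_order all_algebra.
From mathcomp Require Import generic_quotient lra.
From mathcomp Require Import boolp classical_sets functions cardinality.
From mathcomp Require Import reals constructive_ereal ereal topology.

Set Implicit Arguments.
Unset Strict Implicit.
Unset Printing Implicit Defensive.

Import Order.TTheory GRing.Theory Num.Theory.

Local Open Scope ring_scope.

(** Why the theorem is true.

    Choose for every point x of X a point r x of Y with d(x, r x) <= delta.

    Interleaving.  The map phi is induced by the inclusions of the complexes of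
    Y into those of X.  The map psi moves the points a outside Y to r a, one
    after the other; each move is the chain map 1 - (d h + h d), where the
    homotopy h sends a simplex containing a to its cone with apex r a
    ([collapse]).  All simplices met on the way lie in some s0 :|: r @: s0, with
    s0 a simplex of the complex of X at scale t, hence in the complex of X at
    scale t + delta ([rips_star_sub]).  So psi lands in the complex of Y at
    scale t + delta, is the identity on chains of Y, and is homotopic to the
    inclusion on chains of X ([rips_interleaved]).

    Matching.  Rips modules of a finite space have finite-dimensional spaces
    and finitely many critical values, so a diagram comes from a finite family
    of intervals ([rips_diagram_basis]).  In bases adapted to the intervals, phi
    and psi become scalar matrices: an entry of phi from I to J is nonzero only
    if no endpoint of J exceeds that of I, and an entry of psi from J to I
    only if the endpoints of I exceed those of J by at most delta.  Call I and J
    close if all these inequalities hold.  Following Bjerkevik's proof of the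
    algebraic stability theorem, order the intervals by birth + death: if a path
    I -> J -> I' of nonzero entries does not decrease this sum, then J is close
    to I or to I'.  Hence, for a set A of intervals longer than delta, the
    product psi phi may be computed through the intervals close to some member
    of A only, and it is unitriangular on A for that order; therefore at least
    |A| intervals are close to some member of A ([interleaved_hall]).  The
    marriage theorem ([hall]) matches all long intervals of the module of Y into
    that of X; the same argument with phi and psi exchanged gives the converse,
    and an alternating-path argument merges the two matchings into one covering
    the long intervals on both sides ([merge_matchings]).

    Infinite deaths are replaced by a real M beyond all finite endpoints, so
    that birth + death makes sense. *)

(** * Collapsing a vertex of a simplicial complex *)

Section Chains.
Context (k : fieldType) (V : finType).
Local Notation chain := {ffun {set V} -> k^o}.
Implicit Types (c z : chain) (s : {set V}) (u v : V) (K L : {set {set V}}).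

(** The n-chains of K are the functions supported on the n-simplices of K. *)
Lemma memv_chains K n c :
  reflect (forall s, c s != 0 -> s \in K /\ #|s| = n.+1) (c \in chains k K n).
Proof.
apply: (iffP idP) => [|cK].
  rewrite /chains => cK s; set X := in_tuple [seq simplex_chain k s | s <- enum K & #|s| == n.+1].
  rewrite (coord_span (X := X) cK) sum_ffunE.
  apply: contra_neqP => sK; apply: big1 => i _.
  rewrite ffunE.
  have /mapP[s'] : X`_i \in X by apply: mem_nth; exact: ltn_ord.
  rewrite mem_filter mem_enum => /andP[/eqP s'n s'K] ->.
  rewrite ffunE; case: eqP => [ss'|_]; last by rewrite scaler0.
  by case: sK; rewrite ss'.
have -> : c = \sum_(s in [pred s | (s \in K) && (#|s| == n.+1)])
                c s *: simplex_chain k s.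
  apply/ffunP => s; rewrite sum_ffunE.
  case: (boolP (s \in [pred s | (s \in K) && (#|s| == n.+1)])) => sP.
    rewrite (bigD1 s)//= big1 => [|s' /andP[_ /negPf s's]].
      by rewrite !ffunE eqxx addr0 [RHS]mulr1.
    by rewrite !ffunE eq_sym s's scaler0.
  rewrite big1 => [|s' s'P].
    by apply/eqP; apply: contraNT sP => /cK[sK sn]; rewrite inE sK sn/=.
  rewrite !ffunE; case: eqP => [ss'|_]; last by rewrite scaler0.
  by case/negP: sP; rewrite ss'.
apply: memv_suml => s; rewrite inE => /andP[sK sn].
by apply/memvZ/memv_span/map_f; rewrite mem_filter mem_enum sn.
Qed.

Lemma vertex_pos_setD1 s v : vertex_pos (s :\ v) v = vertex_pos s v.
Proof.
apply: eq_card => u; rewrite !inE.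
by case: (eqVneq u v) => [->|_] /=; rewrite ?ltnn ?andbF.
Qed.

Lemma vertex_posU1 s v : vertex_pos (v |: s) v = vertex_pos s v.
Proof.
apply: eq_card => u; rewrite !inE.
by case: (eqVneq u v) => [->|_] /=; rewrite ?ltnn ?andbF.
Qed.

(** The sign of the face s :\ v in the boundary of v |: s. *)
Definition vertex_sign s v : k := (-1) ^+ vertex_pos s v.

Lemma vertex_signK s v : vertex_sign s v * vertex_sign s v = 1.
Proof. by rewrite /vertex_sign -expr2 sqrr_sign. Qed.

Lemma vertex_sign_anticomm s u v : u != v -> u \notin s -> v \notin s ->
  vertex_sign (u |: s) v * vertex_sign s u =
  - (vertex_sign (v |: s) u * vertex_sign s v).
Proof.
move=> uv us vs; rewrite /vertex_sign.
rewrite (@vertex_posD1 _ (u |: s) u v) ?setU11// (@vertex_posD1 _ (v |: s) v u) ?setU11//.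
rewrite !setU1K//.
have : enum_rank u != enum_rank v by rewrite (inj_eq enum_rank_inj).
case: (ltngtP (enum_rank u) (enum_rank v)) => [_ _|_ _|/val_inj->]; last by rewrite eqxx.
- by rewrite add1n add0n exprS mulN1r mulNr mulrC.
- by rewrite add1n add0n exprS mulN1r mulNr opprK mulrC.
Qed.

(** The boundary, coefficient by coefficient: the simplices with face s are the
    v |: s. *)
Lemma boundaryE c s : boundary c s =
  if s == finset.set0 then 0
  else \sum_(v | v \notin s) vertex_sign s v * c (v |: s).
Proof.
rewrite /boundary sum_ffunE.
under eq_bigr => t _.
  rewrite ffunE /simplex_boundary sum_ffunE.
  under eq_bigr => v _ do rewrite !ffunE.
  rewrite scaler_sumr; over.
rewrite /=.
case: ifPn => [/eqP->|s0].
  apply: big1 => t _; apply: big1 => v /andP[_]; rewrite eq_sym => /negPf->.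
  by rewrite !scaler0.
rewrite (exchange_big_dep predT)//= [RHS]big_mkcond/=.
apply: eq_bigr => v _; case: ifPn => vs; last first.
  rewrite big1// => t _; case: eqP => [st|_]; last by rewrite !scaler0.
  by move: vs; rewrite st !inE eqxx.
rewrite (bigD1 (v |: s)) /=; last by rewrite setU11 setU1K.
rewrite setU1K// eqxx vertex_posU1 big1 ?addr0 => [|t].
  by rewrite /GRing.scale/= mulr1 mulrC.
move=> /andP[/andP[vt _] ts]; case: eqP => [st|_]; last by rewrite !scaler0.
by case/eqP: ts; rewrite st finset.setD1K.
Qed.

Section Collapse.
Variables a b : V.

(** On simplices containing a, the cone with apex b (zero if b is already a
    vertex); zero on the other simplices. *)
Definition cone_star c : chain :=
  [ffun s : {set V} => if (b \in s) && (a \in (s :\ b)%SET)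
             then vertex_sign s b * c (s :\ b) else 0].

Fact cone_star_linear : linear cone_star.
Proof.
move=> x c c'; apply/ffunP => s; rewrite !ffunE.
case: ifP => _; last by rewrite scaler0 addr0.
by rewrite /GRing.scale/= mulrDr mulrCA.
Qed.

HB.instance Definition _ :=
  GRing.isLinear.Build k chain chain _ cone_star cone_star_linear.

(** The chain map induced by moving the vertex a to b, written as
    1 - (d h + h d) with h := [cone_star]; this form makes it homotopic to the
    identity, and a chain map because d d = 0. *)
Definition collapse c : chain :=
  c - (boundary (cone_star c) + cone_star (boundary c)).

Fact collapse_linear : linear collapse.
Proof.
move=> x c c'; rewrite /collapse !linearP /=.
by rewrite scalerBr scalerDr [X in _ - X]addrACA opprD addrACA.
Qed.

HB.instance Definition _ :=
  GRing.isLinear.Build k chain chain _ collapse collapse_linear.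

Lemma boundary_collapse c : boundary (collapse c) = collapse (boundary c).
Proof. by rewrite /collapse !linearB !linearD /= !boundaryK ?linear0 ?addr0 ?add0r. Qed.

Hypothesis ab : a != b.

(** After the collapse, a no longer occurs: on the simplices s containing a,
    d h + h d is the identity. If b is not in s, only the coefficient of d h on
    b |: s contributes; if b is in s, the terms of d h and h d cancel by
    [vertex_sign_anticomm] except the term of h d coming from s itself. *)
Lemma collapse_star c s : a \in s -> collapse c s = 0.
Proof.
move=> sa; rewrite !ffunE.
have s0 : s != finset.set0 by apply/set0Pn; exists a.
rewrite (boundaryE (cone_star c) s) (negPf s0).
case: (boolP (b \in s)) => bs /=; last first.
  rewrite addr0 (bigD1 b)//= big1 => [|v /andP[vs vb]].
    rewrite ffunE setU11 setU1K//= sa addr0 /vertex_sign vertex_posU1.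
    by rewrite mulrA -/(vertex_sign s b) vertex_signK mul1r subrr.
  by rewrite ffunE !inE eq_sym (negPf vb) (negPf bs)/= mulr0.
have sb0 : s :\ b != finset.set0 by apply/set0Pn; exists a; rewrite !inE ab.
rewrite !inE ab sa/= (boundaryE c (s :\ b)) (negPf sb0).
rewrite [\sum_(v | v \notin s :\ b) _](bigD1 b) ?inE ?eqxx // mulrDr mulrA finset.setD1K //=.
rewrite /vertex_sign vertex_pos_setD1 -/(vertex_sign s b) vertex_signK mul1r.
rewrite addrCA opprD addrA subrr add0r; apply/eqP; rewrite oppr_eq0; apply/eqP.
rewrite mulr_sumr [X in _ + X](eq_bigl (fun v => v \notin s)); last first.
  by move=> v /=; rewrite in_setD1; case: (eqVneq v b) => [->|_]; rewrite ?bs ?andbT ?andbF.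
rewrite -big_split/= big1// => v vs.
have vb : v != b by apply: contraNneq vs => ->.
rewrite ffunE !inE bs sa ab !orbT/= !mulrA.
have -> : (v |: s) :\ b = v |: (s :\ b).
  by apply/setP => u; rewrite !inE; case: (eqVneq u v) => [->|//]; rewrite vb.
have bs' : b \notin (s :\ b)%SET by rewrite !inE eqxx.
have vs' : v \notin (s :\ b)%SET by rewrite !inE vb (negPf vs).
(* The two terms of the vertex v are opposite; the first is multiplied by the
   square of the sign of b in s :\ b so that the anticommutation rule applies. *)
have E := @vertex_sign_anticomm (s :\ b) b v _ bs' vs'.
move: E; rewrite finset.setD1K// eq_sym => /(_ vb) E.
rewrite -mulrDl -!/(vertex_sign _ _).
have -> : vertex_sign (v |: s) b = vertex_sign (v |: (s :\ b)) b.
  rewrite /vertex_sign -(vertex_pos_setD1 (v |: s) b); congr (_ ^+ vertex_pos _ _).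
  by apply/setP => u; rewrite !inE; case: (eqVneq u v) => [->|//]; rewrite vb.
have -> : vertex_sign s b = vertex_sign (s :\ b) b by rewrite /vertex_sign vertex_pos_setD1.
set x := vertex_sign s v in E *; set y := vertex_sign (v |: _) b in E *.
set p := vertex_sign _ b in E *; set q := vertex_sign _ v in E *.
have -> : x * y = (x * p) * (y * p).
  by rewrite [RHS]mulrACA [p * p]vertex_signK mulr1.
by rewrite E mulNr mulrACA [y * y]vertex_signK mul1r [q * p]mulrC addNr mul0r.
Qed.

End Collapse.

Lemma boundary_neq0 c s : boundary c s != 0 ->
  s != finset.set0 /\ exists2 v, v \notin s & c (v |: s) != 0.
Proof.
rewrite boundaryE; case: ifPn => [|s0 /negP h]; first by rewrite eqxx.
split=> //; apply: contrapT => H; apply: h; apply/eqP; apply: big1 => v vs.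
apply/eqP; rewrite mulf_eq0; apply/orP; right.
by apply: contrapT => /negP cv; apply: H; exists v.
Qed.

Lemma cone_star_neq0 a b c s : cone_star a b c s != 0 ->
  [/\ b \in s, a \in (s :\ b)%SET & c (s :\ b) != 0].
Proof.
rewrite ffunE; case: ifP => [/andP[-> ->]|]; last by rewrite eqxx.
by move=> h; split=> //; apply: contraNneq h => ->; rewrite mulr0.
Qed.

(** K is closed under nonempty codimension-one faces. *)
Definition face_closed K := forall s v, s \in K -> v \in s ->
  (s :\ v)%SET != finset.set0 -> (s :\ v)%SET \in K.

(** The cone with apex b of any simplex of K containing a is in K. *)
Definition star_closed K a b := forall s, s \in K -> a \in s -> (b |: s)%SET \in K.

Lemma cone_star_chains K a b n c : star_closed K a b ->
  c \in chains k K n -> cone_star a b c \in chains k K n.+1.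
Proof.
move=> Kab /memv_chains cK; apply/memv_chains => s /cone_star_neq0[bs asb /cK[sbK sn]].
rewrite -(finset.setD1K bs); split; first exact: Kab.
by rewrite cardsU1 !inE eqxx sn.
Qed.

Lemma boundary_chains K n c : face_closed K ->
  c \in chains k K n.+1 -> boundary c \in chains k K n.
Proof.
move=> Kf /memv_chains cK; apply/memv_chains => s /boundary_neq0[s0 [v vs /cK[vsK]]].
rewrite cardsU1 vs add1n => -[->]; split=> //.
by rewrite -(setU1K vs); apply: Kf; rewrite ?setU11 ?setU1K.
Qed.

(** The empty simplex is left out of boundaries, so that of a 0-chain is zero. *)
Lemma boundary_chains0 K c : c \in chains k K 0 -> boundary c = 0.
Proof.
move=> /memv_chains cK; apply/ffunP => s; rewrite [RHS]ffunE; apply/eqP/negPn/negP.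
move=> /boundary_neq0[s0 [v vs /cK[_]]].
by rewrite cardsU1 vs add1n => -[] /eqP; rewrite cards_eq0 (negPf s0).
Qed.

Lemma collapse_chains K a b n c : a != b -> face_closed K -> star_closed K a b ->
  c \in chains k K n ->
  collapse a b c \in chains k [set s in K | a \notin s]%SET n.
Proof.
move=> ab Kf Kab cK; have hK := cone_star_chains Kab cK.
have : collapse a b c \in chains k K n.
  rewrite rpredB ?rpredD//; first exact: boundary_chains.
  case: n cK {hK} => [|n] cK; first by rewrite (boundary_chains0 cK) linear0 mem0v.
  exact: cone_star_chains (boundary_chains Kf cK).
move=> /memv_chains fK; apply/memv_chains => s cs; have [sK sn] := fK _ cs.
rewrite inE sK sn; split=> //; apply: contraNN cs => sa.
by rewrite collapse_star.
Qed.

Lemma collapse_id a b c : (forall s, a \in s -> c s = 0) -> collapse a b c = c.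
Proof.
move=> ca; rewrite /collapse.
have h0 c' : (forall s, a \in s -> c' s = 0) -> cone_star a b c' = 0.
  move=> c'a; apply/ffunP => s; rewrite [RHS]ffunE; apply/eqP/negPn/negP.
  by move=> /cone_star_neq0[_ asb]; rewrite c'a ?eqxx.
rewrite !h0// ?linear0 ?addr0 ?subr0// => s sa; apply/eqP/negPn/negP.
move=> /boundary_neq0[_ [v _]]; rewrite ca ?eqxx//.
by rewrite inE sa orbT.
Qed.

Lemma collapse_cycle K a b n z : star_closed K a b ->
  z \in cycles k K n -> collapse a b z - z \in boundaries k K n.
Proof.
move=> Kab; rewrite memv_cap memv_ker lfunE /= => /andP[zK /eqP dz].
rewrite /collapse dz linear0 addr0 addrAC subrr add0r rpredN.
apply/memv_imgP; exists (cone_star a b z); first exact: cone_star_chains.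
by rewrite lfunE.
Qed.

Section Retraction.
Variables (Y : {set V}) (r : V -> V).
Hypothesis rY : forall v, r v \in Y.

(** Moves each vertex a of l to r a, successively. *)
Fixpoint retract (l : seq V) c : chain :=
  if l is a :: l' then retract l' (collapse a (r a) c) else c.

Fact retract_linear l : linear (retract l).
Proof. by elim: l => [|a l IH] //= x c c'; rewrite linearP IH. Qed.

HB.instance Definition _ l :=
  GRing.isLinear.Build k chain chain _ (retract l) (retract_linear l).

Lemma boundary_retract l c : boundary (retract l c) = retract l (boundary c).
Proof. by elim: l c => [|a l IH] c //=; rewrite IH boundary_collapse. Qed.

Lemma retract_id l c : (forall s a, a \in l -> a \in s -> c s = 0) ->
  retract l c = c.
Proof.
elim: l => [|a l IH] //= ca; rewrite collapse_id.
  by apply: IH => s u ul; apply: ca; rewrite inE ul orbT.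
by move=> s; apply: ca; rewrite inE eqxx.
Qed.

(** Vertices already moved do not come back, since r takes its values in Y
    and l avoids Y. *)
Lemma retract_chains l K n c : (forall a, a \in l -> a \notin Y) ->
  face_closed K -> (forall a, a \notin Y -> star_closed K a (r a)) ->
  c \in chains k K n ->
  retract l c \in chains k [set s in K | [forall a in l, a \notin s]]%SET n /\
  (c \in cycles k K n -> retract l c - c \in boundaries k K n).
Proof.
elim: l K c => [|a l IH] K c lY Kf Kr cK /=.
  split=> [|_]; last by rewrite subrr mem0v.
  move/memv_chains: cK => cK; apply/memv_chains => s /cK[sK ->]; split=> //.
  by rewrite inE sK; apply/forall_inP.
have aY : a \notin Y by apply: lY; rewrite inE eqxx.
have ar : a != r a by apply: contraNneq aY => ->.
set K' := [set s in K | a \notin s]%SET.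
have K'K : K' \subset K by apply/fintype.subsetP => s; rewrite inE => /andP[].
have K'f : face_closed K'.
  move=> s v; rewrite !inE => /andP[sK sa] vs sv; rewrite Kf//= (negPf sa) andbF//.
have K'r u : u \notin Y -> star_closed K' u (r u).
  move=> uY s; rewrite !inE => /andP[sK sa] us; rewrite Kr//= (negPf sa) orbF.
  by apply: contraNneq aY => ->.
have fK := collapse_chains ar Kf (Kr _ aY) cK.
have lY' u : u \in l -> u \notin Y by move=> ul; apply: lY; rewrite inE ul orbT.
have [IH1 IH2] := IH K' _ lY' K'f K'r fK; split.
  move/memv_chains: IH1 => H; apply/memv_chains => s /H[].
  rewrite !inE => /andP[/andP[sK sa] /forall_inP sl] ->; split=> //.
  rewrite sK; apply/forall_inP => u; rewrite inE => /predU1P[->//|]; exact: sl.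
move=> cZ; have -> : retract l (collapse a (r a) c) - c =
  (retract l (collapse a (r a) c) - collapse a (r a) c) + (collapse a (r a) c - c).
  by rewrite addrA subrK.
rewrite rpredD//; last exact: collapse_cycle (Kr _ aY) cZ.
apply: (subvP (boundaries_sub _ _ K'K)); apply: IH2.
rewrite memv_cap fK/= memv_ker lfunE/= boundary_collapse.
by move: cZ; rewrite memv_cap memv_ker lfunE/= => /andP[_ /eqP->]; rewrite linear0.
Qed.

End Retraction.

End Chains.

(** * The interleaving of the Vietoris-Rips modules *)

Section VQuotMap.
Context (k : fieldType) (vT vT' : vectType k).
Context (Z B : {vspace vT}) (Z' B' : {vspace vT'}) (F : {linear vT -> vT'}).

(** The linear map Z / B -> Z' / B' induced by a linear map F. *)
Definition vquot_map of (forall z, z \in Z -> F z \in Z')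
    & (forall z, z \in B -> F z \in B') :=
  fun q : vquot Z B => (\pi_(vquot Z' B') (vsproj Z' (F (vsval (repr q)))))%qT.

Context (FZ : forall z, z \in Z -> F z \in Z').
Context (FB : forall z, z \in B -> F z \in B').

Local Notation map := (vquot_map FZ FB).

Lemma vquot_map_pi (x : subvs_of Z) :
  map (\pi_(vquot Z B) x)%qT = (\pi_(vquot Z' B') (vsproj Z' (F (vsval x))))%qT.
Proof.
apply/eqP; rewrite vquot_eqE !vsprojK ?FZ ?subvsP//.
by rewrite -linearB FB// repr_vquotP.
Qed.

Fact vquot_map_linear : linear map.
Proof.
move=> a; elim/quotW=> x; elim/quotW=> y.
rewrite -pi_vquotZ -pi_vquotD !vquot_map_pi.
by rewrite -pi_vquotZ -pi_vquotD !linearP.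
Qed.

HB.instance Definition _ :=
  GRing.isLinear.Build k (vquot Z B) (vquot Z' B') _ map vquot_map_linear.

End VQuotMap.

Section HomologyClass.
Context (k : fieldType) (V : finType) (n : nat).
Implicit Types K L : {set {set V}}.

(** The homology class of a cycle. *)
Definition homology_class K (x : subvs_of (cycles k K n)) : homology k K n :=
  (\pi_(vquot (cycles k K n) (boundaries k K n)) x)%qT.

Lemma homology_classW K (P : homology k K n -> Prop) :
  (forall x, P (homology_class x)) -> forall h, P h.
Proof. by move=> H; elim/quotW => x; exact: H. Qed.

Lemma homology_class_eq K (x y : subvs_of (cycles k K n)) :
  vsval x - vsval y \in boundaries k K n -> homology_class x = homology_class y.
Proof. by move=> xy; apply/eqP; rewrite vquot_eqE. Qed.

Lemma homology_incl_class K L (KL : K \subset L) (x : subvs_of (cycles k K n)) :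
  homology_incl k n KL (homology_class x) = homology_class (vsproj _ (vsval x)).
Proof. exact: vquot_incl_pi. Qed.

End HomologyClass.

Section RipsInterleaving.
Context (k : fieldType) (R : realType) (X : finMetricType R).
Variables (Y : {set X}) (delta : R) (r : X -> X).
Hypotheses (rY : forall x, r x \in Y) (rdelta : forall x, mdist x (r x) <= delta).
Hypothesis delta0 : 0 <= delta.

(** The nonempty subsets of the s0 :|: r @: s0, for s0 a simplex of the complex
    of X at scale t: all moves from a to r a can be made inside this complex. *)
Definition rips_star (t : R) : {set {set X}} :=
  [set s : {set X} | (s != finset.set0) &&
    [exists s0 in rips [set: X]%SET t, s \subset s0 :|: (r @: s0)%SET]]%SET.

Lemma rips_star_face t : face_closed (rips_star t).
Proof.
move=> s v; rewrite !inE => /andP[_ /exists_inP[s0 s0t ss0]] vs -> /=.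
apply/exists_inP; exists s0 => //.
exact: fintype.subset_trans (finset.subD1set _ _) ss0.
Qed.

Lemma rips_star_closed t a : a \notin Y -> star_closed (rips_star t) a (r a).
Proof.
move=> aY s; rewrite !inE => /andP[_ /exists_inP[s0 s0t ss0]] sa.
apply/andP; split; first by apply/set0Pn; exists (r a); rewrite setU11.
apply/exists_inP; exists s0 => //; rewrite finset.subUset ss0 andbT finset.sub1set inE.
move: (fintype.subsetP ss0 a sa); rewrite inE => /orP[as0|/imsetP[x _ ax]].
  by rewrite imset_f ?orbT.
by move: aY; rewrite ax rY.
Qed.

Lemma sub_rips_star t : rips [set: X]%SET t \subset rips_star t.
Proof.
apply/fintype.subsetP => s st; rewrite inE; apply/andP; split.
  by move: st; rewrite inE => /andP[].
by apply/exists_inP; exists s => //; exact: finset.subsetUl.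
Qed.

Lemma rips_star_sub t : rips_star t \subset rips [set: X]%SET (t + delta).
Proof.
apply/fintype.subsetP => s; rewrite !inE => /andP[-> /exists_inP[s0 s0t ss0]] /=.
rewrite finset.subsetT/=.
have near x : x \in s -> exists2 x0, x0 \in s0 & mdist x0 x <= delta.
  move=> /(fintype.subsetP ss0); rewrite inE => /orP[xs0|/imsetP[x0 x0s0 ->]].
    by exists x; rewrite // mdistxx.
  by exists x0.
move: s0t; rewrite inE => /and3P[_ _ /forall_inP H].
apply/forall_inP => x /near[x0 x0s x0x]; apply/forall_inP => y /near[y0 y0s y0y].
have /forall_inP/(_ _ y0s) h := H _ x0s.
have h1 := metric_triangle x x0 y; have h2 := metric_triangle x0 y0 y.
have h3 := metric_sym x0 x.
lra.
Qed.

Lemma rips_star_subY t :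
  [set s in rips_star t | [forall a in enum (~: Y)%SET, a \notin s]]%SET
    \subset rips Y (t + delta).
Proof.
apply/fintype.subsetP => s; rewrite inE => /andP[/(fintype.subsetP (rips_star_sub t))].
rewrite !inE => /and3P[-> _ ->] /forall_inP sY; rewrite andbT/=.
apply/fintype.subsetP => x xs; apply: contraLR xs => xY; apply: sY.
by rewrite mem_enum inE.
Qed.

Local Notation F := (retract (k := k) r (enum (~: Y)%SET)).

Lemma enumCY a : a \in enum (~: Y)%SET -> a \notin Y.
Proof. by rewrite mem_enum inE. Qed.

Lemma retract_rips_chains t n c : c \in chains k (rips [set: X]%SET t) n ->
  F c \in chains k (rips Y (t + delta)) n.
Proof.
move=> /(subvP (chains_sub _ (sub_rips_star t) _)) ct.
have [+ _] := retract_chains rY enumCY (rips_star_face (t := t)) (@rips_star_closed t) ct.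
exact: (subvP (chains_sub _ (rips_star_subY t) _)).
Qed.

Lemma retract_rips_cycles t n z : z \in cycles k (rips [set: X]%SET t) n ->
  F z \in cycles k (rips Y (t + delta)) n.
Proof.
rewrite !memv_cap !memv_ker !lfunE/= => /andP[/retract_rips_chains-> /eqP dz].
by rewrite boundary_retract dz linear0 eqxx.
Qed.

Lemma retract_rips_boundaries t n z : z \in boundaries k (rips [set: X]%SET t) n ->
  F z \in boundaries k (rips Y (t + delta)) n.
Proof.
move=> /memv_imgP[c ct ->]; rewrite lfunE/= -boundary_retract.
by apply/memv_imgP; exists (F c); [exact: retract_rips_chains|rewrite lfunE].
Qed.

Lemma retract_rips_homotopic t n z : z \in cycles k (rips [set: X]%SET t) n ->
  F z - z \in boundaries k (rips [set: X]%SET (t + delta)) n.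
Proof.
move=> /(subvP (cycles_sub _ _ (sub_rips_star t))) zt.
have ct : z \in chains k (rips_star t) n by move: zt; rewrite memv_cap => /andP[].
have [_ /(_ zt)] := retract_chains rY enumCY (rips_star_face (t := t)) (@rips_star_closed t) ct.
exact: (subvP (boundaries_sub _ _ (rips_star_sub t))).
Qed.

Lemma retract_rips_id t n z : z \in chains k (rips Y t) n -> F z = z.
Proof.
move=> /memv_chains zY; apply: retract_id => s a aY sa.
apply/eqP/negPn/negP => /zY[]; rewrite inE => /and3P[_ /fintype.subsetP/(_ _ sa) + _] _.
by rewrite (negPf (enumCY aY)).
Qed.

Definition retract_homology t n :
    {linear homology k (rips [set: X]%SET t) n -> homology k (rips Y (t + delta)) n} :=
  vquot_map (retract_rips_cycles (t := t) (n := n))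
            (retract_rips_boundaries (t := t) (n := n)).

Lemma retract_homology_class t n x :
  retract_homology t n (homology_class x) =
  homology_class (vsproj _ (F (vsval x))).
Proof. exact: vquot_map_pi. Qed.

Lemma subset_rips (A B : {set X}) t : A \subset B -> rips A t \subset rips B t.
Proof.
move=> AB; apply/fintype.subsetP => s; rewrite !inE => /and3P[-> sA ->].
by rewrite (fintype.subset_trans sA AB).
Qed.

Definition incl_homology t n :
    {linear homology k (rips Y t) n -> homology k (rips [set: X]%SET t) n} :=
  homology_incl k n (subset_rips t (finset.subsetT Y)).

Lemma retract_homology_natural s t n (st : s <= t) (sdtd : s + delta <= t + delta) h :
  retract_homology t n (homology_incl k n (rips_sub _ st) h) =
  homology_incl k n (rips_sub _ sdtd) (retract_homology s n h).
Proof.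
elim/homology_classW: h => x.
rewrite /incl_homology !(homology_incl_class, retract_homology_class).
rewrite vsprojK; last exact: (subvP (cycles_sub _ _ (rips_sub _ st)) _ (subvsP x)).
by rewrite vsprojK// retract_rips_cycles ?subvsP.
Qed.

Lemma retract_inclE t n (td : t <= t + delta) h :
  retract_homology t n (incl_homology t n h) = homology_incl k n (rips_sub Y td) h.
Proof.
elim/homology_classW: h => x.
rewrite /incl_homology !(homology_incl_class, retract_homology_class).
rewrite vsprojK; last first.
  exact: (subvP (cycles_sub _ _ (subset_rips t (finset.subsetT Y))) _ (subvsP x)).
rewrite (@retract_rips_id t n)//.
by move: (subvsP x); rewrite memv_cap => /andP[].
Qed.

Lemma incl_retractE t n (td : t <= t + delta) h :
  incl_homology (t + delta) n (retract_homology t n h) =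
  homology_incl k n (rips_sub [set: X]%SET td) h.
Proof.
elim/homology_classW: h => x.
rewrite /incl_homology !(homology_incl_class, retract_homology_class).
have Fx := retract_rips_cycles (subvsP x).
rewrite (vsprojK Fx); apply: homology_class_eq; rewrite !vsprojK.
- exact: retract_rips_homotopic (subvsP x).
- exact: (subvP (cycles_sub _ _ (rips_sub _ td)) _ (subvsP x)).
- exact: (subvP (cycles_sub _ _ (subset_rips _ (finset.subsetT Y))) _ Fx).
Qed.

Lemma rips_interleaved : interleaved (fun t => t) (fun t => t + delta)
  (rips_module k Y) (rips_module k [set: X]%SET).
Proof.
have H : translation_pair (fun t : R => t) (fun t : R => t + delta).
  have hd : {homo (fun t : R => t + delta) : x y / x <= y}.
    by move=> x y xy; rewrite lerD2r.
  by split=> //; split=> //= x; rewrite lerDl.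
exists H.
pose phi t : {linear rips_module k Y t -> rips_module k [set: X]%SET t} :=
  dsum_map (incl_homology t).
pose psi t : {linear rips_module k [set: X]%SET t -> rips_module k Y (t + delta)} :=
  dsum_map (retract_homology t).
have phiN (s t : R) (st : s <= t) v :
    phi t (pm_map (rips_module k Y) st v) =
    pm_map (pm_shift (rips_module k [set: X]%SET) (tp_homol H)) st (phi s v).
  apply: dsumP => n /=; rewrite /incl_homology.
  have sYX := fintype.subset_trans (rips_sub Y st) (subset_rips t (finset.subsetT Y)).
  by rewrite (homology_incl_comp _ _ sYX) (homology_incl_comp _ _ sYX).
have psiN (s t : R) (st : s <= t) v :
    psi t (pm_map (rips_module k [set: X]%SET) st v) =
    pm_map (pm_shift (rips_module k Y) (tp_homor H)) st (psi s v).
  by apply: dsumP => n; exact: retract_homology_natural.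
exists (@PMHom k R (rips_module k Y)
          (pm_shift (rips_module k [set: X]%SET) (tp_homol H)) phi phiN).
exists (@PMHom k R (rips_module k [set: X]%SET)
          (pm_shift (rips_module k Y) (tp_homor H)) psi psiN); split=> t v; apply: dsumP => n.
- exact: retract_inclE.
- exact: incl_retractE.
Qed.

End RipsInterleaving.

(** * The marriage theorem and merging of matchings *)

Section Hall.
Context (V W : finType) (e : V -> W -> bool).
Implicit Types (A S T : {set V}) (B : {set W}).

(** The elements of W related by e to some element of S. *)
Definition neighbours S : {set W} := [set w | [exists v in S, e v w]]%SET.

Lemma neighboursU S T : neighbours (S :|: T) = neighbours S :|: neighbours T.
Proof.
apply/setP => w; rewrite !inE; apply/exists_inP/orP.
  move=> [v]; rewrite inE => /orP[vS|vT] vw; [left|right];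
  by apply/exists_inP; exists v.
by move=> [] /exists_inP[v vS vw]; exists v; rewrite // inE vS ?orbT.
Qed.

(** Hall's marriage theorem inside the subsets A and B: the matching f is
    total on A. The proof is the induction of Halmos and Vaughan, on whether some
    proper nonempty subset of A has no more neighbours than elements. *)
Theorem hall A B :
  (forall S, S \subset A -> (#|S| <= #|neighbours S :&: B|)%N) ->
  exists2 f : V -> option W,
    (forall v, v \in A -> exists2 w, f v = Some w & (w \in B) && e v w) &
    {in A &, injective f}.
Proof.
have [n] := ubnP #|A|; elim: n A B => // n IH A B; rewrite ltnS => An hallA.
have [->|[v0 v0A]] := set_0Vmem A.
  by exists (fun=> None) => v; rewrite inE.
case: (boolP [exists S : {set V}, [&& S != finset.set0, S \proper A &
    (#|neighbours S :&: B| <= #|S|)%N]]).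
  move=> /existsP[S /and3P[S0 SA Stight]].
  have Sn : (#|S| < n)%N by exact: leq_trans (proper_card SA) An.
  have [|f1 f1B f1inj] := IH S B Sn.
    by move=> T TS; apply: hallA (fintype.subset_trans TS (proper_sub SA)).
  have DSn : (#|A :\: S| < n)%N.
    apply: leq_trans An; rewrite cardsD (finset.setIidPr (proper_sub SA)).
    by rewrite ltn_subrL !card_gt0 S0/=; apply/set0Pn; exists v0.
  have [|f2 f2B f2inj] := IH (A :\: S) (B :\: neighbours S) DSn.
    move=> T; rewrite subsetD => /andP[TA TS].
    have STA : S :|: T \subset A by rewrite finset.subUset (proper_sub SA).
    have := hallA _ STA; rewrite cardsU disjoint_setI0 ?cards0 ?subn0; last first.
      by rewrite disjoint_sym.
    move=> H; rewrite -(leq_add2l #|S|); apply: (leq_trans H).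
    apply: (@leq_trans (#|neighbours S :&: B| + #|neighbours T :&: (B :\: neighbours S)|)).
      apply: leq_trans (leq_card_setU _ _); apply: subset_leq_card.
      apply/fintype.subsetP => w; rewrite neighboursU !inE.
      by case: [exists v in S, e v w]; case: [exists v in T, e v w]; case: (w \in B).
    by rewrite leq_add2r.
  exists (fun v => if v \in S then f1 v else f2 v) => [v vA|v v' vA v'A].
    case: ifPn => vS; first exact: f1B.
    have [|w fw /andP[]] := f2B v; first by rewrite inE vS.
    by rewrite inE => /andP[_ wB] vw; exists w; rewrite // wB.
  have mixed u u' : u \in S -> u' \notin S -> u' \in A -> f1 u = f2 u' -> False.
    move=> uS u'S u'A.
    have [w -> /andP[_ uw]] := f1B _ uS.
    have [|w' -> /andP[+ _]] := f2B u'; first by rewrite inE u'S.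
    rewrite !inE => /andP[/exists_inP h _] [ww']; apply: h; exists u => //.
    by rewrite -ww'.
  case: ifPn => vS; case: ifPn => v'S.
  - exact: f1inj.
  - by move=> /mixed[].
  - by move=> /esym/mixed[].
  - by apply: f2inj; rewrite inE ?vS ?v'S.
rewrite negb_exists => /forallP loose.
have : (0 < #|neighbours [set v0] :&: B|)%N.
  apply: leq_trans (hallA [set v0]%SET _); first by rewrite cards1.
  by rewrite finset.sub1set.
rewrite card_gt0 => /set0Pn[w0]; rewrite !inE => /andP[/exists_inP[v]].
rewrite inE => /eqP-> v0w0 w0B.
have [||f fB finj] := IH (A :\ v0) (B :\ w0).
- by apply: leq_trans An; rewrite [X in (_ < X)%N](cardsD1 v0) v0A.
- move=> T TA.
  have [->|T0] := eqVneq T finset.set0; first by rewrite cards0.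
  have := loose T; rewrite T0/= (sub_proper_trans TA (properD1 v0A))/= -ltnNge.
  move=> H; rewrite -ltnS; apply: (leq_trans H).
  apply: (@leq_trans #|w0 |: (neighbours T :&: (B :\ w0))|); last first.
    by rewrite cardsU1; case: (_ \notin _) => //; rewrite leqW.
  apply: subset_leq_card; apply/fintype.subsetP => w; rewrite !inE.
  by case: (w == w0).
exists (fun v => if v == v0 then Some w0 else f v) => [u uA|u u' uA u'A].
  case: eqVneq => [->|uv0]; first by exists w0; rewrite ?w0B.
  have [|w fw /andP[]] := fB u; first by rewrite !inE uv0.
  by rewrite !inE => /andP[_ wB] uw; exists w; rewrite // wB.
have avoid x : x != v0 -> x \in A -> Some w0 = f x -> False.
  move=> xv xA; have [|w -> /andP[+ _]] := fB x; first by rewrite !inE xv.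
  by rewrite !inE => /andP[/eqP ww _] [] /esym.
case: (eqVneq u v0) => [->|uv]; case: (eqVneq u' v0) => [->//|u'v].
- by move=> /avoid[].
- by move=> /esym/avoid[].
- by apply: finj; rewrite !inE ?uv ?u'v.
Qed.

End Hall.

Section MergeMatchings.
Context (V W : Type) (E : V -> W -> Prop) (A : V -> Prop) (B : W -> Prop).
Context (f : V -> option W) (g : W -> option V).
Hypotheses (fE : forall v, A v -> exists2 w, f v = Some w & E v w).
Hypotheses (gE : forall w, B w -> exists2 v, g w = Some v & E v w).
Hypotheses (finj : forall v v', A v -> A v' -> f v = f v' -> v = v').
Hypotheses (ginj : forall w w', B w -> B w' -> g w = g w' -> w = w').

(** The elements of W reached by alternating paths (g, then f) that start at an
    element of B missed by f. *)
Inductive alternating : W -> Prop :=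
| alternating_start w : B w -> (forall v, A v -> f v <> Some w) -> alternating w
| alternating_step w v w' : alternating w -> g w = Some v -> A v ->
    f v = Some w' -> B w' -> alternating w'.

Lemma alternating_B w : alternating w -> B w.
Proof. by case. Qed.

(** Mendelsohn and Dulmage: from matchings f covering A and g covering B, a
    matching covering both. It uses g along the alternating paths, and f
    elsewhere, as in the proof of the Cantor-Bernstein theorem. *)
Lemma merge_matchings : exists M : V -> W -> Prop,
  [/\ forall v w, M v w -> E v w,
      forall v w w', M v w -> M v w' -> w = w',
      forall v v' w, M v w -> M v' w -> v = v',
      forall v, A v -> exists w, M v w &
      forall w, B w -> exists v, M v w].
Proof.
(* G v: the element v is matched by g on an alternating path. *)
pose G v := exists2 w, alternating w & g w = Some v.
exists (fun v w => [/\ A v, f v = Some w & ~ G v] \/ alternating w /\ g w = Some v).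
split.
- move=> v w [[Av fv _]|[/alternating_B Bw gw]].
    by have [w' + ?] := fE Av; rewrite fv => -[->].
  by have [v' + ?] := gE Bw; rewrite gw => -[->].
- move=> v w w' [[Av fv Gv]|[aw gw]] [[Av' fv' Gv']|[aw' gw']].
  + by move: fv'; rewrite fv => -[].
  + by case: Gv; exists w'.
  + by case: Gv'; exists w.
  + by apply: ginj (alternating_B aw) (alternating_B aw') _; rewrite gw gw'.
- have mixed v w : A v -> f v = Some w -> ~ G v -> alternating w -> False.
    move=> Av fv Gv aw; case: aw fv => {w} [w _ nf|w u w' aw gw Au fu _] fv.
      exact: nf fv.
    apply: Gv; exists w => //; rewrite gw; congr Some.
    by apply: finj => //; rewrite fu fv.
  move=> v v' w [[Av fv Gv]|[aw gw]] [[Av' fv' Gv']|[aw' gw']].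
  + by apply: finj => //; rewrite fv fv'.
  + by case: (mixed v w).
  + by case: (mixed v' w).
  + by move: gw'; rewrite gw => -[].
- move=> v Av; have [[w aw gw]|Gv] := pselect (G v); first by exists w; right.
  by have [w fv _] := fE Av; exists w; left.
- move=> w Bw; have [aw|naw] := pselect (alternating w).
    by have [v gw _] := gE Bw; exists v; right.
  have [v Av fv] : exists2 v, A v & f v = Some w.
    apply: contrapT => H; apply: naw; apply: alternating_start => // v Av fv.
    by apply: H; exists v.
  exists v; left; split=> // -[w' aw' gw'].
  exact/naw/(alternating_step aw' gw' Av fv Bw).
Qed.

End MergeMatchings.

(** * Hall's condition for interleaved interval modules *)

Lemma itv_between (d : Order.disp_t) (T : porderType d) (J : interval T) (s t u : T) :
  s \in J -> u \in J -> (s <= t)%O -> (t <= u)%O -> t \in J.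
Proof.
move=> sJ uJ st tu.
have /subitvP : (`[s, u] <= J)%O; last by apply; rewrite in_itv /= st tu.
by case: J sJ uJ => [x y]; rewrite subitvE !itv_boundlr => /andP[-> _] /andP[_ ->].
Qed.

(** A linear system with fewer equations (B) than unknowns (A) has a nonzero
    solution. *)
Lemma small_system_kernel (k : fieldType) (I J : finType) (A : {set I}) (B : {set J})
    (P : J -> I -> k) : (#|B| < #|A|)%N ->
  exists2 x : I -> k, (exists2 i, i \in A & x i != 0) &
    (forall j, j \in B -> \sum_(i in A) P j i * x i = 0).
Proof.
move=> BA.
pose M := \matrix_(i < #|A|, j < #|B|) P (enum_val j) (enum_val i).
have rM : (\rank (kermx M) > 0)%N.
  rewrite mxrank_ker subn_gt0; exact: leq_ltn_trans (rank_leq_col M) BA.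
have /rowV0Pn[v vM v0] : kermx M != 0 by rewrite -mxrank_eq0 -lt0n.
have {}vM : v *m M = 0 by apply/sub_kermxP.
have [i0 i0v] : exists i, v 0 i != 0.
  by apply/existsP; rewrite -negb_forall; apply: contra_neqN v0 => /forallP v0;
     apply/rowP => i; rewrite mxE; apply/eqP; exact: v0.
have i0A := enum_valP i0.
pose x i := v 0 (enum_rank_in i0A i).
have xE (i : 'I_#|A|) : x (enum_val i) = v 0 i by rewrite /x enum_valK_in.
exists x; first by exists (enum_val i0); rewrite ?xE.
move=> j jB; rewrite big_enum_val /=.
have := congr1 (fun N : 'rV_ _ => N 0 (enum_rank_in jB j)) vM.
rewrite !mxE => E; rewrite -[RHS]E; apply: eq_bigr => i _.
by rewrite mxE enum_rankK_in// xE mulrC.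
Qed.

(** The data of an interleaving, in coordinates: F j i t is the entry from the
    interval i of V at t to the interval j of W at tau t, and G i j t the entry
    from j at t to i at sigma t; b and d are real endpoints. *)
Section InterleavedScalars.
Context (k : fieldType) (R : realType) (I J : finType).
Context (JI : I -> interval R) (JJ : J -> interval R).
Context (tau sigma : R -> R) (a c : R).
Context (F : J -> I -> R -> k) (G : I -> J -> R -> k).
Context (bI dI : I -> R) (bJ dJ : J -> R).
Hypotheses (tauE : forall t, tau t = t + a) (sigmaE : forall t, sigma t = t + c).
Hypothesis ac0 : 0 <= a + c.
Hypothesis Fsupp : forall j i t, F j i t != 0 -> t \in JI i /\ tau t \in JJ j.
Hypothesis Gsupp : forall i j t, G i j t != 0 -> t \in JJ j /\ sigma t \in JI i.
Hypothesis Fconst : forall j i s t, s <= t -> s \in JI i -> tau t \in JJ j ->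
  F j i s = F j i t.
Hypothesis Gconst : forall i j s t, s <= t -> s \in JJ j -> sigma t \in JI i ->
  G i j s = G i j t.
Hypothesis comp : forall i i' t, t \in JI i -> sigma (tau t) \in JI i' ->
  \sum_j G i' j (tau t) * F j i t = (i == i')%:R.
Hypothesis inner : forall i t, bI i < t -> t < dI i -> t \in JI i.
Hypothesis Fend : forall j i t, F j i t != 0 -> bJ j <= bI i + a /\ dJ j <= dI i + a.
Hypothesis Gend : forall i j t, G i j t != 0 -> bI i <= bJ j + c /\ dI i <= dJ j + c.

(** The endpoints of i and j are as close as the shifts a and c permit. *)
Definition close_intervals (i : I) (j : J) :=
  [&& bJ j <= bI i + a, bI i <= bJ j + c, dJ j <= dI i + a & dI i <= dJ j + c].

(** The value that F j i takes wherever it is nonzero, and 0 if it vanishes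
    identically: in both cases, its value at a point chosen in its support when
    there is one. Likewise for G. *)
Definition Fval j i : k := F j i (xget 0 [set t | F j i t != 0]%classic).
Definition Gval i j : k := G i j (xget 0 [set t | G i j t != 0]%classic).

Lemma FvalE j i t : F j i t != 0 -> F j i t = Fval j i.
Proof.
move=> Ft; rewrite /Fval; set u := xget _ _.
have Fu : F j i u != 0 by have := @xgetI _ 0 [set t | F j i t != 0]%classic t Ft.
have [tI tJ] := Fsupp Ft; have [uI uJ] := Fsupp Fu.
by have [tu|/ltW ut] := leP t u; [exact: Fconst|apply/esym/Fconst].
Qed.

Lemma GvalE i j t : G i j t != 0 -> G i j t = Gval i j.
Proof.
move=> Gt; rewrite /Gval; set u := xget _ _.
have Gu : G i j u != 0 by have := @xgetI _ 0 [set t | G i j t != 0]%classic t Gt.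
have [tI tJ] := Gsupp Gt; have [uI uJ] := Gsupp Gu.
by have [tu|/ltW ut] := leP t u; [exact: Gconst|apply/esym/Gconst].
Qed.

(** At a point t where the i -> i' entry of the composite makes sense, the
    constant matrices compute it: a nonzero product Gval * Fval forces
    tau t into the interval j, by convexity. *)
Lemma GFval i i' j t : t \in JI i -> sigma (tau t) \in JI i' ->
  Gval i' j * Fval j i = G i' j (tau t) * F j i t.
Proof.
move=> ti ti'.
have [GF0|] := eqVneq (G i' j (tau t) * F j i t) 0; last first.
  by rewrite mulf_eq0 negb_or => /andP[/GvalE-> /FvalE->].
rewrite GF0; apply/eqP/negPn/negP; rewrite mulf_eq0 negb_or => /andP[].
rewrite /Gval /Fval; set v := xget _ _; set u := xget _ _ => Gv Fu.
have [vJ vI] := Gsupp Gv; have [uI uJ] := Fsupp Fu.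
have tJ : tau t \in JJ j.
  have [tu|/ltW ut] := leP t u.
    have : F j i t != 0 by rewrite (Fconst tu).
    by move=> /Fsupp[].
  have [vt|/ltW tv] := leP v (tau t).
    have : G i' j (tau t) != 0 by rewrite -(Gconst vt).
    by move=> /Gsupp[].
  by apply: itv_between uJ vJ _ tv; rewrite !tauE lerD2r.
suff /andP[Gt Ft] : (G i' j (tau t) != 0) && (F j i t != 0).
  by move/eqP: GF0; rewrite mulf_eq0 (negPf Gt) (negPf Ft).
apply/andP; split.
- have [vt|/ltW tv] := leP v (tau t); first by rewrite -(Gconst vt).
  by rewrite (Gconst tv).
- have [tu|/ltW ut] := leP t u; first by rewrite (Fconst tu).
  by rewrite -(Fconst ut).
Qed.

(** The key inequality: a path i -> j -> i' along which b + d does not decrease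
    passes through an interval close to i or to i'. *)
Lemma close_of_path i i' j : bI i + dI i <= bI i' + dI i' ->
  Gval i' j != 0 -> Fval j i != 0 -> close_intervals i j || close_intervals i' j.
Proof.
move=> ii' /Gend[g1 g2] /Fend[f1 f2]; rewrite /close_intervals f1 f2 g1 g2 /=.
rewrite !andbT; case: (leP (bI i)) => /= h1.
  case: (leP (dI i)) => //= h2; lra.
lra.
Qed.

Section HallCondition.
Variable A : {set I}.
Hypothesis Along : forall i, i \in A -> bI i + (a + c) < dI i.

(** Through the neighbours of A only, the product Gval * Fval restricted to A is
    unitriangular for the order by b + d. *)
Lemma GFval_sum i i' : i \in A -> i' \in A -> bI i + dI i <= bI i' + dI i' ->
  \sum_(j in neighbours close_intervals A) Gval i' j * Fval j i = (i == i')%:R.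
Proof.
move=> iA i'A ii'.
have -> : \sum_(j in neighbours close_intervals A) Gval i' j * Fval j i =
          \sum_j Gval i' j * Fval j i.
  rewrite [RHS](bigID (mem (neighbours close_intervals A)))/=.
  rewrite [X in _ = _ + X]big1 ?addr0// => j; apply: contraNeq.
  rewrite mulf_eq0 negb_or => /andP[Gn Fn]; rewrite inE; apply/exists_inP.
  by have /orP[] := close_of_path ii' Gn Fn; [exists i|exists i'].
have Ai := Along iA; have Ai' := Along i'A.
(* Under these inequalities the two intervals, the second shifted down by
   a + c, share an interior point, because both are longer than a + c. *)
have common : dI i' - (a + c) <= dI i -> bI i' - (a + c) <= bI i ->
    \sum_j Gval i' j * Fval j i = (i == i')%:R.
  move=> dd bb; pose t := (bI i + (dI i' - (a + c))) / 2.
  have ti : t \in JI i by apply: inner; rewrite /t; lra.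
  have ti' : sigma (tau t) \in JI i' by apply: inner; rewrite sigmaE tauE /t; lra.
  by under eq_bigr => j _ do rewrite (GFval _ ti ti'); exact: comp.
have [ii|/eqP nii] := pselect (i = i').
  by apply: common; rewrite ii lerBlDr lerDl.
have [[j]|nopath] := pselect (exists j, Gval i' j * Fval j i != 0).
  by rewrite mulf_eq0 negb_or => /andP[/Gend[g1 g2] /Fend[f1 f2]]; apply: common; lra.
rewrite (negPf nii); apply: big1 => j _; apply/eqP/negPn/negP => h.
by apply: nopath; exists j.
Qed.

(** With fewer neighbours than elements, some nonzero vector supported in A would
    be killed by Fval on the neighbours; its coefficient of largest b + d must
    vanish by unitriangularity. *)
Lemma interleaved_hall : (#|A| <= #|neighbours close_intervals A|)%N.
Proof.
rewrite leqNgt; apply/negP => /(small_system_kernel Fval)[x [i0 i0A xi0] xker].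
pose supp := [pred i | (i \in A) && (x i != 0)].
have si0 : supp i0 by rewrite /= i0A.
pose i1 := [arg max_(i > i0 | supp i) (bI i + dI i)]%O.
have [/andP[i1A xi1] i1max] : supp i1 /\ forall i, supp i -> bI i + dI i <= bI i1 + dI i1.
  by rewrite /i1; case: arg_maxP => // i si imax; split=> // i' /imax.
have : \sum_(j in neighbours close_intervals A)
         Gval i1 j * \sum_(i in A) Fval j i * x i = 0.
  by apply: big1 => j jn; rewrite xker ?mulr0.
under eq_bigr => j _ do rewrite mulr_sumr.
rewrite exchange_big/= (bigD1 i1)//= [X in _ + X]big1 => [|i /andP[iA ii1]].
  under eq_bigr => j _ do rewrite mulrA.
  by rewrite -mulr_suml GFval_sum// eqxx mul1r addr0 => /eqP; rewrite (negPf xi1).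
under eq_bigr => j _ do rewrite mulrA.
rewrite -mulr_suml; have [->|xi] := eqVneq (x i) 0; first by rewrite mulr0.
by rewrite GFval_sum ?(negPf ii1) ?mul0r// i1max//= iA.
Qed.

End HallCondition.
End InterleavedScalars.

(** * Finiteness of Vietoris-Rips modules *)

Section DirectSumCoordinates.
Context (k : fieldType) (I : Type) (V : I -> lmodType k).

(** Coordinates of a direct sum. *)
Definition dsum_proj (i : I) (f : dsum V) : V i := f i.

Fact dsum_proj_linear i : linear (dsum_proj i).
Proof. by []. Qed.

HB.instance Definition _ i :=
  GRing.isLinear.Build k (dsum V) (V i) _ (dsum_proj i) (dsum_proj_linear i).

Lemma dsum_sumE (T : Type) (s : seq T) (P : pred T) (F : T -> dsum V) i :
  (\sum_(x <- s | P x) F x) i = \sum_(x <- s | P x) F x i.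
Proof. exact: (linear_sum (dsum_proj i)). Qed.

(** The family with value x at i and 0 elsewhere; the summands depend on the
    index, so x is transported along i = j. *)
Definition dsum_inj_fun (i : I) (x : V i) (j : I) : V j :=
  if pselect (i = j) is left ij then eq_rect i V x j ij else 0.

Lemma dsum_inj_funE i (x : V i) : dsum_inj_fun x i = x.
Proof.
rewrite /dsum_inj_fun; case: pselect => // ii.
by rewrite (Prop_irrelevance ii erefl).
Qed.

Lemma dsum_inj_fun0 i (x : V i) j : i <> j -> dsum_inj_fun x j = 0.
Proof. by rewrite /dsum_inj_fun; case: pselect. Qed.

Fact dsum_inj_finite i (x : V i) : finite_set [set j | dsum_inj_fun x j != 0]%classic.
Proof.
apply: (sub_finite_set _ (finite_set1 i)) => j /= xj.
by apply: contrapT => ji; rewrite dsum_inj_fun0 ?eqxx// in xj => ij; exact: ji.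
Qed.

(** Inclusion of a summand. *)
Definition dsum_inj i (x : V i) : dsum V := DSum (dsum_inj_finite x).

Fact dsum_inj_linear i : linear (@dsum_inj i).
Proof.
move=> a x y; apply: dsumP => j /=.
have [<-|ij] := pselect (i = j); first by rewrite !dsum_inj_funE.
by rewrite !dsum_inj_fun0// scaler0 addr0.
Qed.

HB.instance Definition _ i :=
  GRing.isLinear.Build k (V i) (dsum V) _ (@dsum_inj i) (@dsum_inj_linear i).

End DirectSumCoordinates.

Section FiniteSupport.
Context (k : fieldType).

(** Every linear map from U to a direct sum lands in finitely many summands. This
    stands for finite dimension: it holds for finite-dimensional spaces, passes
    to quotients and finite sums, and bounds the number of interval summands. *)
Definition finitely_supported (U : lmodType k) : Prop :=
  forall (I : Type) (V : I -> lmodType k) (f : {linear U -> dsum V}),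
    exists2 D : set I, finite_set D & forall u i, f u i != 0 -> D i.

Lemma finitely_supported_vect (U : vectType k) : finitely_supported U.
Proof.
move=> I V f; set e := vbasis {:U}%VS.
exists (\bigcup_(l in [set: 'I_(\dim {:U})]) [set i | f e`_l i != 0])%classic.
  by apply: bigcup_finite => [|l _]; [exact: finite_finset|exact: dsum_finite].
move=> u i fui; apply: contrapT => H; move/eqP: fui; apply.
rewrite (coord_vbasis (memvf u)) linear_sum/= dsum_sumE big1// => l _.
rewrite linearZ/=; apply/eqP; rewrite scaler_eq0; apply/orP; right.
by apply/negPn/negP => h; apply: H; exists l.
Qed.

Lemma finitely_supported_surj (U U' : lmodType k) (q : {linear U -> U'}) :
  (forall u', exists u, q u = u') -> finitely_supported U -> finitely_supported U'.
Proof.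
move=> qs Us I V f; have [D Df Dsupp] := Us I V (f \o q).
by exists D => // u' i; have [u <-] := qs u'; exact: Dsupp.
Qed.

(** Only the first N summands are nonzero. *)
Lemma finitely_supported_dsum (H : nat -> lmodType k) (N : nat) :
  (forall n, finitely_supported (H n)) ->
  (forall n (x : H n), (N <= n)%N -> x = 0) ->
  finitely_supported (dsum H).
Proof.
move=> Hs HN I V f.
have /choice[D DP] n : exists D : set I, finite_set D /\
    forall u i, f (dsum_inj (u : H n)) i != 0 -> D i.
  by have [D ? ?] := Hs n I V (f \o @dsum_inj k nat H n); exists D.
exists (\bigcup_(n in [set: 'I_N]) D n)%classic.
  by apply: bigcup_finite => [|n _]; [exact: finite_finset|have [] := DP n].
move=> u i fui; apply: contrapT => nD; move/eqP: fui; apply.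
have -> : u = \sum_(n < N) dsum_inj (u n).
  apply: dsumP => m; rewrite dsum_sumE.
  have [mN|Nm] := ltnP m N; last first.
    rewrite (HN _ (u m) Nm) big1// => n _ /=; rewrite dsum_inj_fun0// => nm.
    by move: (ltn_ord n); rewrite nm ltnNge Nm.
  rewrite (bigD1 (Ordinal mN))//= dsum_inj_funE big1 ?addr0// => n nm.
  rewrite dsum_inj_fun0// => nm'; move/eqP: nm; apply; exact: val_inj.
rewrite linear_sum/= dsum_sumE big1// => n _; apply/eqP/negPn/negP => h.
by apply: nD; exists n => //; have [_] := DP n; apply; exact: h.
Qed.

Lemma finitely_supported_homology (V : finType) (K : {set {set V}}) n :
  finitely_supported (homology k K n).
Proof.
pose q (x : subvs_of (cycles k K n)) : homology k K n :=
  (\pi_(vquot (cycles k K n) (boundaries k K n)) x)%qT.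
have ql : linear q by move=> a x y; rewrite /q pi_vquotD pi_vquotZ.
pose Q : {linear subvs_of (cycles k K n) -> homology k K n} :=
  HB.pack q (GRing.isLinear.Build k _ _ _ q ql).
apply: (@finitely_supported_surj _ _ Q); last exact: finitely_supported_vect.
by elim/quotW => x; exists x.
Qed.

End FiniteSupport.

Lemma homology_eq0 (k : fieldType) (V : finType) (K : {set {set V}}) n :
  (forall s, s \in K -> #|s| != n.+1) -> forall h : homology k K n, h = 0.
Proof.
move=> Kn; elim/quotW => x; have -> : x = 0; last exact: raddf0.
apply: val_inj => /=; have := subvsP x; rewrite memv_cap => /andP[+ _].
rewrite /chains -(@eq_in_filter _ pred0) ?filter_pred0 ?span_nil ?memv0; last first.
  by move=> s; rewrite mem_enum => /Kn/negPf->.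
by move/eqP.
Qed.

Section RipsTame.
Context (k : fieldType) (R : realType) (X : finMetricType R) (A : {set X}).

Lemma rips_module_finitely_supported t : finitely_supported (rips_module k A t).
Proof.
apply: (@finitely_supported_dsum _ _ #|X|) => [n|n h Xn].
  exact: finitely_supported_homology.
apply: homology_eq0 => s _; rewrite neq_ltn ltnS.
by rewrite (leq_trans (max_card _) Xn).
Qed.

(** A nonempty complex at scale t is already the complex at the largest
    half-distance not exceeding t. *)
Lemma rips_critical t : rips A t = finset.set0 \/
  exists p : X * X, mdist p.1 p.2 / 2 <= t /\
    rips A t \subset rips A (mdist p.1 p.2 / 2).
Proof.
have [|[s]] := set_0Vmem (rips A t); [by left|right].
move: p; rewrite inE => /and3P[/set0Pn[x xs] _ /forall_inP/(_ _ xs)/forall_inP/(_ _ xs) xx].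
pose P := [pred p : X * X | mdist p.1 p.2 <= 2 * t].
have Px : P (x, x) by [].
have [q Pq qmax] := @arg_maxP _ _ _ (x, x) P (fun p => mdist p.1 p.2) Px.
exists q; rewrite ler_pdivrMr// [t * 2]mulrC; split=> //.
apply/fintype.subsetP => s'; rewrite !inE => /and3P[-> -> /forall_inP H] /=.
apply/forall_inP => u us'; apply/forall_inP => v vs'.
rewrite mulrC divfK ?pnatr_eq0//; apply: (qmax (u, v)).
by have /forall_inP/(_ _ vs') := H _ us'.
Qed.

(** A nonzero space of the module is hit by the transition map from one of the
    finitely many critical values, all nonnegative. *)
Lemma rips_module_tame t : (forall v : rips_module k A t, v = 0) \/
  exists2 p : X * X, 0 <= mdist p.1 p.2 / 2 &
    exists ct : mdist p.1 p.2 / 2 <= t,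
      forall v, exists u, pm_map (rips_module k A) ct u = v.
Proof.
have [r0|[p [pt rp]]] := rips_critical t; [left|right].
  move=> v; apply: dsumP => n; apply: homology_eq0 => s.
  by rewrite r0 inE.
exists p; first by rewrite divr_ge0// mdist_ge0.
exists pt => v; exists (dsum_map (fun n => homology_incl k n rp) v).
by apply: dsumP => n /=; rewrite (homology_incl_comp _ _ (subxx _)) homology_incl_id.
Qed.

End RipsTame.

(** * Bases adapted to an interval decomposition *)

Section BarcodeBasis.
Context (k : fieldType) (R : realType).

(** A decomposition of V into the interval modules of the J i, in coordinates:
    [bar_gen i t] generates the i-th summand at t (it is 0 outside J i), and
    [bar_coord i t] is the dual coordinate. *)
Record barcode_basis (V : persmod k R) (I : finType) (J : I -> interval R) :=
  BarcodeBasis {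
    bar_gen : I -> forall t, V t;
    bar_coord : I -> forall t, {linear V t -> k^o};
    bar_gen0 : forall i t, t \notin J i -> bar_gen i t = 0;
    bar_coord0 : forall i t v, t \notin J i -> bar_coord i t v = 0;
    bar_dual : forall i i' t, t \in J i ->
      bar_coord i' t (bar_gen i t) = (i == i')%:R;
    bar_expand : forall t v, v = \sum_i bar_coord i t v *: bar_gen i t;
    bar_gen_map : forall i s t (st : s <= t), s \in J i ->
      pm_map V st (bar_gen i s) = bar_gen i t;
    bar_coord_map : forall i s t (st : s <= t) v, t \in J i ->
      bar_coord i t (pm_map V st v) = bar_coord i s v }.

End BarcodeBasis.

Section IntervalSum.
Context (k : fieldType) (R : realType).

(** The unit vector of the interval module; zero outside the interval. *)
Definition itv_gen (J : interval R) t : itv_module k J t := vsproj (itv_space k J t) 1.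

Lemma itv_genE (J : interval R) t : t \in J -> vsval (itv_gen J t) = 1.
Proof. by move=> tJ; rewrite vsprojK// /itv_space tJ memvf. Qed.

Lemma itv_gen_scale (J : interval R) t (x : itv_module k J t) :
  x = (vsval x : k) *: itv_gen J t.
Proof.
apply: val_inj => /=; case: (boolP (t \in J)) => tJ.
  by rewrite itv_genE// [RHS]mulr1.
by rewrite (itv_space0 x tJ) scale0r.
Qed.

Lemma itv_map_val (J : interval R) s t (st : s <= t) (x : itv_module k J s) :
  t \in J -> vsval (pm_map (itv_module k J) st x) = vsval x.
Proof. by move=> tJ /=; rewrite vsprojK// /itv_space tJ memvf. Qed.

Lemma itv_map_gen (J : interval R) s t (st : s <= t) : s \in J ->
  pm_map (itv_module k J) st (itv_gen J s) = itv_gen J t.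
Proof. by move=> sJ; rewrite /= itv_genE. Qed.

Context (V : persmod k R) (I : Type) (J : I -> interval R).
Context (phi : pm_hom V (pm_dsum (fun i => itv_module k (J i)))).
Hypothesis phi_bij : forall t, bijective (phi t).

Lemma barcode_finite_at t : finitely_supported (V t) ->
  finite_set [set i | t \in J i]%classic.
Proof.
move=> /(_ _ _ (phi t))[D Df Dsupp]; apply: sub_finite_set Df => i /= ti.
have [g _ gK] := phi_bij t.
apply: (Dsupp (g (dsum_inj (V := fun i => itv_module k (J i) t) (itv_gen (J i) t)))).
rewrite gK /= dsum_inj_funE; apply/negP => /eqP /(congr1 vsval).
by rewrite itv_genE// => /eqP; rewrite linear0 oner_eq0.
Qed.

Lemma barcode_neq0 t i : t \in J i -> ~ (forall v : V t, v = 0).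
Proof.
move=> ti V0; have [g _ gK] := phi_bij t.
pose x := dsum_inj (V := fun i => itv_module k (J i) t) (itv_gen (J i) t).
have := gK x; rewrite (V0 (g x)) linear0 => /(congr1 (fun y : dsum _ => y i)).
rewrite /= dsum_inj_funE => /(congr1 vsval).
by rewrite itv_genE// => /eqP; rewrite linear0 eq_sym oner_eq0.
Qed.

(** Intervals containing t contain any s from which the transition map to t is
    onto. *)
Lemma barcode_surj s t (st : s <= t) i : (forall v, exists u, pm_map V st u = v) ->
  t \in J i -> s \in J i.
Proof.
move=> Vst ti; apply/negPn/negP => si.
have [g _ gK] := phi_bij t.
pose x := dsum_inj (V := fun i => itv_module k (J i) t) (itv_gen (J i) t).
have [u gx] := Vst (g x).
have := gK x; rewrite -gx pm_hom_natural => /(congr1 (fun y : dsum _ => y i)).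
rewrite /= dsum_inj_funE => /(congr1 vsval).
rewrite itv_genE// (itv_space0 (phi s u i) si) !linear0 => /eqP.
by rewrite eq_sym oner_eq0.
Qed.

(** The index type I of the decomposition is enumerated by a finite type. *)
Lemma barcode_basis_of_iso (T : finType) (g : T -> I) :
  injective g -> (forall i, exists m, g m = i) ->
  inhabited (barcode_basis V (J \o g)).
Proof.
move=> ginj gsurj.
have inv t : exists h : pm_dsum (fun i => itv_module k (J i)) t -> V t,
    cancel (phi t) h /\ cancel h (phi t).
  by have [h] := phi_bij t; exists h.
pose h t := projT1 (cid (inv t)).
have hK t : cancel (phi t) (h t) by exact: (projT2 (cid (inv t))).1.
have Kh t : cancel (h t) (phi t) by exact: (projT2 (cid (inv t))).2.
pose gen m t : V t :=
  h t (dsum_inj (V := fun i => itv_module k (J i) t) (itv_gen (J (g m)) t)).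
pose coord m t : {linear V t -> k^o} :=
  vsval \o (dsum_proj (V := fun i => itv_module k (J i) t) (g m) \o phi t).
have gen_self m t : phi t (gen m t) (g m) = itv_gen (J (g m)) t.
  by rewrite /gen Kh /= dsum_inj_funE.
have gen_other m t i : g m <> i -> phi t (gen m t) i = 0.
  by move=> mi; rewrite /gen Kh /= dsum_inj_fun0.
have phi_inj t u v : (forall i, phi t u i = phi t v i) -> u = v.
  by move=> uv; apply: (can_inj (hK t)); exact: dsumP.
split; exists gen coord.
- move=> m t tm; apply: phi_inj => i; rewrite linear0.
  have [<-|mi] := pselect (g m = i); last by rewrite gen_other.
  by rewrite gen_self; apply: val_inj; rewrite /= (itv_space0 _ tm).
- by move=> m t v tm; rewrite /coord /= (itv_space0 _ tm).
- move=> m m' t tm; rewrite /coord /= /dsum_proj; have [<-|mm'] := eqVneq m m'.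
    by rewrite gen_self itv_genE.
  by rewrite gen_other ?linear0// => /ginj/eqP; rewrite (negPf mm').
- move=> t v; apply: phi_inj => i; have [m <-] := gsurj i.
  rewrite linear_sum dsum_sumE (bigD1 m)//= big1 ?addr0 => [|m' m'm].
    rewrite linearZ /= gen_self; exact: itv_gen_scale.
  by rewrite linearZ /= gen_other ?scaler0// => /ginj/eqP; rewrite (negPf m'm).
- move=> m s t st sm; apply: phi_inj => i; rewrite pm_hom_natural.
  have [<-|mi] := pselect (g m = i); last by rewrite /= !gen_other// !linear0.
  by rewrite gen_self /= gen_self; exact: itv_map_gen.
- move=> m s t st v tm; rewrite /coord /= /dsum_proj pm_hom_natural.
  exact: itv_map_val.
Qed.

End IntervalSum.

Lemma finite_set_ord (I : Type) : finite_set [set: I] ->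
  exists (n : nat) (g : 'I_n -> I), injective g /\ forall i, exists m, g m = i.
Proof.
move=> /finite_setP[n /card_set_bijP[f [fn finj fsurj]]].
have /choice[g gP] (m : 'I_n) : exists i, f i = m.
  by have [i _ fi] := fsurj m (ltn_ord m); exists i.
exists n, g; split=> [m m' mm'|i].
  by apply: val_inj; rewrite -[LHS]gP -[RHS]gP mm'.
have fi : (f i < n)%N by exact: fn.
by exists (Ordinal fi); apply: finj; rewrite ?inE// gP.
Qed.

Section RipsDiagram.
Context (k : fieldType) (R : realType) (X : finMetricType R) (A : {set X}).

(** The intervals behind a diagram of a Rips module are finitely many, since each
    contains a critical value and only finitely many contain a given one. *)
Lemma rips_diagram_basis (D : set (dgm_point R)) :
  persistence_diagram (rips_module k A) D ->
  exists (n : nat) (J : 'I_n -> interval R) (p : 'I_n -> dgm_point R),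
  [/\ inhabited (barcode_basis (rips_module k A) J),
      forall m, ([set` J m] !=set0)%classic,
      forall m t, t \in J m -> 0 <= t,
      set_bij [set: 'I_n]%classic D p &
      forall m, (p m).1.1 = ereal_inf (EFin @` [set` J m])%classic /\
                (p m).1.2 = ereal_sup (EFin @` [set` J m])%classic].
Proof.
move=> [I [J [p [J0 [phi phi_bij] [pD pinj psurj] pE]]]].
have crit i t : t \in J i -> exists2 q : X * X,
    0 <= mdist q.1 q.2 / 2 & mdist q.1 q.2 / 2 <= t /\ mdist q.1 q.2 / 2 \in J i.
  move=> ti; have [V0|[q q0 [qt qsurj]]] := rips_module_tame k A t.
    by case: (barcode_neq0 phi_bij ti V0).
  by exists q => //; split=> //; exact: (barcode_surj phi_bij qsurj ti).
have finI : finite_set [set: I]%classic.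
  apply: (@sub_finite_set _ _ (\bigcup_(q in [set: X * X])
      [set i | mdist q.1 q.2 / 2 \in J i])%classic).
    by move=> i _; have [t /crit[q _ [_ qi]]] := J0 i; exists q.
  apply: bigcup_finite => [|q _]; first exact: finite_finset.
  exact/(barcode_finite_at phi_bij)/rips_module_finitely_supported.
have [n [g [ginj gsurj]]] := finite_set_ord finI.
exists n, (J \o g), (p \o g); split=> [|m|m t /crit[q q0 [qt _]]||m].
- exact: (barcode_basis_of_iso phi_bij ginj gsurj).
- exact: J0.
- exact: le_trans q0 qt.
- split=> [m _|m m' _ _ pmm|x /psurj[i _ <-]] /=; first exact: pD.
    by apply/ginj/(pinj _ _ _ _ pmm); rewrite inE.
  by have [m <-] := gsurj i; exists m.
- by have [] := pE (g m).
Qed.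

End RipsDiagram.

(** * From interleavings to matrices *)

Section HomEntries.
Context (k : fieldType) (R : realType) (V W : persmod k R) (I J : finType).
Context (JV : I -> interval R) (JW : J -> interval R).
Context (BV : barcode_basis V JV) (BW : barcode_basis W JW).
Context (tau : R -> R) (tau_homo : {homo tau : x y / x <= y}).
Context (phi : pm_hom V (pm_shift W tau_homo)).

(** The matrix entry of phi at t, from the interval i of V to the interval j
    of W. *)
Definition hom_entry (j : J) (i : I) (t : R) : k :=
  bar_coord BW j (tau t) (phi t (bar_gen BV i t)).

Lemma hom_entry_supp j i t : hom_entry j i t != 0 -> t \in JV i /\ tau t \in JW j.
Proof.
rewrite /hom_entry => h; split; apply/negPn/negP => n; move/eqP: h; apply.
  by rewrite bar_gen0// !linear0.
by rewrite bar_coord0.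
Qed.

(** Entries are constant as long as source and target intervals are alive. *)
Lemma hom_entry_const j i s t : s <= t -> s \in JV i -> tau t \in JW j ->
  hom_entry j i s = hom_entry j i t.
Proof.
move=> st si tj; rewrite /hom_entry -(bar_gen_map BV st si) pm_hom_natural /=.
by rewrite bar_coord_map.
Qed.

End HomEntries.

Lemma hom_entry_comp (k : fieldType) (R : realType) (V W : persmod k R)
    (I J : finType) (JV : I -> interval R) (JW : J -> interval R)
    (BV : barcode_basis V JV) (BW : barcode_basis W JW)
    (tau sigma : R -> R) (tau_homo : {homo tau : x y / x <= y})
    (sigma_homo : {homo sigma : x y / x <= y})
    (phi : pm_hom V (pm_shift W tau_homo)) (psi : pm_hom W (pm_shift V sigma_homo))
    (st : forall t, t <= sigma (tau t)) :
  (forall t (v : V t), psi (tau t) (phi t v) = pm_map V (st t) v) ->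
  forall i i' t, t \in JV i -> sigma (tau t) \in JV i' ->
  \sum_j hom_entry BW BV psi i' j (tau t) * hom_entry BV BW phi j i t = (i == i')%:R.
Proof.
move=> psiphi i i' t ti ti'.
have := psiphi t (bar_gen BV i t).
rewrite [phi t _](bar_expand BW) bar_gen_map// => /(congr1 (bar_coord BV i' _)).
rewrite !linear_sum /=.
under eq_bigr => j _ do rewrite !linearZ /=.
have -> : bar_coord BV i' (sigma (tau t)) (bar_gen BV i (sigma (tau t))) = (i == i')%:R.
  have [ti2|ti2] := boolP (sigma (tau t) \in JV i); first by rewrite bar_dual.
  rewrite bar_gen0// linear0; case: eqP => // ii'.
  by move: ti2; rewrite ii' ti'.
by move=> E; rewrite -[RHS]E; apply: eq_bigr => j _; rewrite mulrC.
Qed.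

Section Endpoints.
Context (R : realType).
Implicit Types (J : interval R) (M : R) (x y : \bar R).

(** Undecorated endpoints of an interval. *)
Definition itv_inf J : \bar R := (ereal_inf (EFin @` [set` J]))%classic.
Definition itv_sup J : \bar R := (ereal_sup (EFin @` [set` J]))%classic.

(** Replaces infinite values by the real M. *)
Definition truncate M x : R := if x is r%:E then r else M.

Lemma truncate_le M x y a : x != -oo%E -> y != -oo%E -> 0 <= a ->
  (forall r, x = r%:E -> r <= M) ->
  (x <= y + a%:E)%E -> truncate M x <= truncate M y + a.
Proof.
case: x => [x| |]//; case: y => [y| |]//= _ _ a0 xM.
- by move=> _; rewrite (le_trans (xM x erefl))// lerDl.
- by rewrite lerDl.
Qed.

Lemma truncate_le_inv M x y a : x != -oo%E -> y != -oo%E ->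
  (forall r, y = r%:E -> r + a < M) ->
  truncate M x <= truncate M y + a -> (x <= y + a%:E)%E.
Proof.
case: x => [x| |]//; case: y => [y| |]//= _ _ yM.
- by rewrite leey.
- by rewrite leNgt (yM y erefl).
Qed.

(** If the entry f from J1 to J2 is nonzero somewhere, then J2, shifted down by
    a, lies weakly below J1. *)
Lemma shifted_endpoints (k : fieldType) J1 J2 (f : R -> k) (tau : R -> R) (a : R) :
  (forall t, tau t = t + a) ->
  (forall t, f t != 0 -> t \in J1 /\ tau t \in J2) ->
  (forall s t, s <= t -> s \in J1 -> tau t \in J2 -> f s = f t) ->
  forall t, f t != 0 ->
    (itv_inf J2 <= itv_inf J1 + a%:E)%E /\ (itv_sup J2 <= itv_sup J1 + a%:E)%E.
Proof.
move=> tauE fsupp fconst t ft; have [t1 t2] := fsupp t ft; split.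
- rewrite -leeBlDr//; apply/ereal_infP => _ [s /= s1 <-].
  rewrite EFinN leeBlDr//; apply: ge_ereal_inf.
  have [st|/ltW ts] := leP s t.
    exists (s + a)%:E => //=; exists (s + a) => //=.
    by rewrite -tauE; apply: (fsupp s _).2; rewrite (fconst _ _ st).
  exists (tau t)%:E; first by exists (tau t).
  by rewrite -EFinD lee_fin tauE lerD2r.
- apply: ge_ereal_sup => _ [s /= s2 <-]; rewrite -leeBlDr// -EFinB.
  have [ts|st] := leP t (s - a).
    apply: ereal_sup_ubound; exists (s - a) => //=.
    by apply: (fsupp (s - a) _).1; rewrite -(fconst _ _ ts)// tauE subrK.
  apply: (@le_trans _ _ t%:E); first by rewrite lee_fin ltW.
  by apply: ereal_sup_ubound; exists t.
Qed.

Lemma itv_between_ends J t : (itv_inf J < t%:E)%E -> (t%:E < itv_sup J)%E -> t \in J.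
Proof.
move=> /ereal_inf_lt[_ [s /= sJ <-] st] /ereal_sup_gt[_ [u /= uJ <-] tu].
by apply: (itv_between sJ uJ); rewrite ltW.
Qed.

(** Nonempty intervals of nonnegative reals: the left endpoint is real. *)
Definition nonneg_itv J := ([set` J] !=set0)%classic /\ forall t, t \in J -> 0 <= t.

Lemma itv_inf_fin J : nonneg_itv J -> itv_inf J = (fine (itv_inf J))%:E.
Proof.
move=> [[t tJ] J0]; rewrite fineK// fin_numE; apply/andP; split.
  rewrite gt_eqF//; apply: (@lt_le_trans _ _ 0%:E); first exact: ltNyr.
  by apply/ereal_infP => _ [s /= sJ <-]; rewrite lee_fin J0.
rewrite lt_eqF//; apply: (@le_lt_trans _ _ t%:E); last exact: ltry.
by apply: ereal_inf_lbound; exists t.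
Qed.

Lemma itv_supN J : nonneg_itv J -> itv_sup J != -oo%E.
Proof.
move=> [[t tJ] _]; rewrite gt_eqF//; apply: (@lt_le_trans _ _ t%:E).
  exact: ltNyr.
by apply: ereal_sup_ubound; exists t.
Qed.

Lemma truncate_gt M x t : t < truncate M x -> (forall r, x = r%:E -> r < M) ->
  x != -oo%E -> (t%:E < x)%E.
Proof. by case: x => [x| |] //= _ _ _; exact: ltry. Qed.

Lemma exists_upper_bound (T : finType) (f : T -> R) : exists M, forall i, f i < M.
Proof.
exists (1 + \sum_i `|f i|) => i; rewrite (bigD1 i)//=.
have h1 := ler_norm (f i); have h2 : 0 <= \sum_(j | j != i) `|f j| by exact: sumr_ge0.
lra.
Qed.

End Endpoints.

Section HalfMatching.
Context (k : fieldType) (R : realType) (V W : persmod k R) (I J : finType).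
Context (JV : I -> interval R) (JW : J -> interval R).
Context (BV : barcode_basis V JV) (BW : barcode_basis W JW).
Hypotheses (JV0 : forall i, nonneg_itv (JV i)) (JW0 : forall j, nonneg_itv (JW j)).
Context (tau sigma : R -> R) (a c : R).
Hypotheses (tauE : forall t, tau t = t + a) (sigmaE : forall t, sigma t = t + c).
Hypotheses (a0 : 0 <= a) (c0 : 0 <= c).
Context (tau_homo : {homo tau : x y / x <= y}).
Context (sigma_homo : {homo sigma : x y / x <= y}).
Context (phi : pm_hom V (pm_shift W tau_homo)) (psi : pm_hom W (pm_shift V sigma_homo)).
Context (st : forall t, t <= sigma (tau t)).
Hypothesis psiphi : forall t (v : V t), psi (tau t) (phi t v) = pm_map V (st t) v.
Variable M : R.
Hypothesis MV : forall i r, itv_sup (JV i) = r%:E -> r < M.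
Hypothesis MW : forall j r, itv_sup (JW j) = r%:E -> r < M.

Local Notation bI i := (fine (itv_inf (JV i))).
Local Notation dI i := (truncate M (itv_sup (JV i))).
Local Notation bJ j := (fine (itv_inf (JW j))).
Local Notation dJ j := (truncate M (itv_sup (JW j))).

(** The intervals of V longer than a + c can be matched to close intervals of W. *)
Lemma half_matching : exists2 f : I -> option J,
  (forall i, bI i + (a + c) < dI i -> exists2 j, f i = Some j &
    close_intervals a c (fun i => bI i) (fun i => dI i) (fun j => bJ j) (fun j => dJ j) i j) &
  (forall i i', bI i + (a + c) < dI i -> bI i' + (a + c) < dI i' -> f i = f i' -> i = i').
Proof.
pose A : {set I} := [set i | bI i + (a + c) < dI i]%SET.
have hallA (S : {set I}) : S \subset A -> (#|S| <= #|neighbours (close_intervals a c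
    (fun i => bI i) (fun i => dI i) (fun j => bJ j) (fun j => dJ j)) S :&: [set: J]%SET|)%N.
  move=> SA; rewrite finset.setIT.
  apply: (@interleaved_hall k R I J JV JW tau sigma a c
            (hom_entry BV BW phi) (hom_entry BW BV psi)) => //.
  - exact: addr_ge0.
  - exact: hom_entry_supp.
  - exact: hom_entry_supp.
  - exact: hom_entry_const.
  - exact: hom_entry_const.
  - exact: hom_entry_comp psiphi.
  - move=> i t bt td; apply: itv_between_ends.
      by rewrite itv_inf_fin// lte_fin.
    by apply: truncate_gt td _ _ => //; [exact: MV|exact: itv_supN].
  - move=> j i t /(shifted_endpoints tauE (@hom_entry_supp _ _ _ _ _ _ _ _ BV BW _ _ phi j i)
                     (@hom_entry_const _ _ _ _ _ _ _ _ BV BW _ _ phi j i))[h1 h2].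
    split; last by apply: truncate_le h2 => //; rewrite ?itv_supN// => r /MW/ltW.
    by move: h1; rewrite (itv_inf_fin (JV0 i)) (itv_inf_fin (JW0 j)) -EFinD lee_fin.
  - move=> i j t /(shifted_endpoints sigmaE (@hom_entry_supp _ _ _ _ _ _ _ _ BW BV _ _ psi i j)
                     (@hom_entry_const _ _ _ _ _ _ _ _ BW BV _ _ psi i j))[h1 h2].
    split; last by apply: truncate_le h2 => //; rewrite ?itv_supN// => r /MV/ltW.
    by move: h1; rewrite (itv_inf_fin (JV0 i)) (itv_inf_fin (JW0 j)) -EFinD lee_fin.
  - by move=> i iS; have := fintype.subsetP SA i iS; rewrite inE.
have [f fA finj] := hall hallA; exists f => [i iA|i i' iA i'A].
  by have [|j fj /andP[_ ij]] := fA i; [rewrite inE|exists j].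
by apply: finj; rewrite inE.
Qed.

End HalfMatching.

(** * Matchings of barcodes and of diagrams *)

Section BarcodeMatching.
Context (k : fieldType) (R : realType) (V W : persmod k R) (I J : finType).
Context (JV : I -> interval R) (JW : J -> interval R).
Context (BV : barcode_basis V JV) (BW : barcode_basis W JW).
Hypotheses (JV0 : forall i, nonneg_itv (JV i)) (JW0 : forall j, nonneg_itv (JW j)).
Context (a c : R) (a0 : 0 <= a) (c0 : 0 <= c).

(** The inequalities of [close_intervals], for extended real endpoints. *)
Definition close_bars (i : I) (j : J) : Prop :=
  [/\ (itv_inf (JW j) <= itv_inf (JV i) + a%:E)%E,
      (itv_inf (JV i) <= itv_inf (JW j) + c%:E)%E,
      (itv_sup (JW j) <= itv_sup (JV i) + a%:E)%E &
      (itv_sup (JV i) <= itv_sup (JW j) + c%:E)%E].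

(** Algebraic stability for an interleaving by the shifts a and c. *)
Theorem barcode_matching (tau sigma : R -> R) :
  (forall t, tau t = t + a) -> (forall t, sigma t = t + c) ->
  interleaved tau sigma V W ->
  exists M : I -> J -> Prop,
  [/\ forall i j, M i j -> close_bars i j,
      forall i j j', M i j -> M i j' -> j = j',
      forall i i' j, M i j -> M i' j -> i = i',
      forall i, (forall j, ~ M i j) ->
        (itv_sup (JV i) <= itv_inf (JV i) + (a + c)%:E)%E &
      forall j, (forall i, ~ M i j) ->
        (itv_sup (JW j) <= itv_inf (JW j) + (a + c)%:E)%E].
Proof.
move=> tauE sigmaE [H [phi [psi [psiphi phipsi]]]].
have [M1 M1P] := exists_upper_bound (fun i => truncate 0 (itv_sup (JV i)) + (a + c)).
have [M2 M2P] := exists_upper_bound (fun j => truncate 0 (itv_sup (JW j)) + (a + c)).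
have [M3 M3P] := exists_upper_bound (fun i => fine (itv_inf (JV i)) + (a + c)).
have [M4 M4P] := exists_upper_bound (fun j => fine (itv_inf (JW j)) + (a + c)).
(* M exceeds every finite endpoint by more than a + c, so that truncation at M
   neither creates nor destroys closeness, and infinite bars count as long. *)
pose M := Num.max (Num.max M1 M2) (Num.max M3 M4).
have MV i r : itv_sup (JV i) = r%:E -> r + (a + c) < M.
  by move=> ir; have := M1P i; rewrite ir /= /M !lt_max => ->.
have MW j r : itv_sup (JW j) = r%:E -> r + (a + c) < M.
  by move=> jr; have := M2P j; rewrite jr /= /M !lt_max => ->; rewrite orbT.
have MbV i : fine (itv_inf (JV i)) + (a + c) < M by rewrite /M !lt_max M3P !orbT.
have MbW j : fine (itv_inf (JW j)) + (a + c) < M by rewrite /M !lt_max M4P !orbT.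
have below r : r + (a + c) < M -> r < M.
  by apply: le_lt_trans; rewrite lerDl addr_ge0.
have [f fE finj] := half_matching BV BW JV0 JW0 tauE sigmaE a0 c0 psiphi
  (fun i r ir => below _ (MV i r ir)) (fun j r jr => below _ (MW j r jr)).
have [g gE ginj] := half_matching BW BV JW0 JV0 sigmaE tauE c0 a0 phipsi
  (fun j r jr => below _ (MW j r jr)) (fun i r ir => below _ (MV i r ir)).
rewrite [c + a]addrC in gE ginj.
set bI := fun i => fine (itv_inf (JV i)) in fE finj gE.
set dI := fun i => truncate M (itv_sup (JV i)) in fE finj gE.
set bJ := fun j => fine (itv_inf (JW j)) in fE gE ginj.
set dJ := fun j => truncate M (itv_sup (JW j)) in fE gE ginj.
have gE' j : bJ j + (a + c) < dJ j ->
    exists2 i, g j = Some i & close_intervals a c bI dI bJ dJ i j.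
  move=> /gE[i gj]; rewrite /close_intervals => /and4P[h1 h2 h3 h4].
  by exists i => //; rewrite h1 h2 h3 h4.
have [Mt [MtE Mt1 Mt2 MtA MtB]] := merge_matchings fE gE' finj ginj.
exists Mt; split=> //.
- move=> i j /MtE /and4P[h1 h2 h3 h4]; split.
  + by rewrite (itv_inf_fin (JV0 i)) (itv_inf_fin (JW0 j)) -EFinD lee_fin.
  + by rewrite (itv_inf_fin (JV0 i)) (itv_inf_fin (JW0 j)) -EFinD lee_fin.
  + apply: truncate_le_inv h3; rewrite ?itv_supN// => r /MV.
    by apply: le_lt_trans; rewrite lerD2l lerDl.
  + apply: truncate_le_inv h4; rewrite ?itv_supN// => r /MW.
    by apply: le_lt_trans; rewrite lerD2l lerDr.
- move=> i iN; have : ~~ (bI i + (a + c) < dI i).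
    by apply/negP => /MtA[j]; exact: iN.
  rewrite -leNgt /dI (itv_inf_fin (JV0 i)) -EFinD.
  case E : (itv_sup (JV i)) => [r| |] /= h; [by rewrite lee_fin| |by rewrite leNye].
  by move: (MbV i); rewrite ltNge h.
- move=> j jN; have : ~~ (bJ j + (a + c) < dJ j).
    by apply/negP => /MtB[i]; exact: jN.
  rewrite -leNgt /dJ (itv_inf_fin (JW0 j)) -EFinD.
  case E : (itv_sup (JW j)) => [r| |] /= h; [by rewrite lee_fin| |by rewrite leNye].
  by move: (MbW j); rewrite ltNge h.
Qed.

End BarcodeMatching.

(** A relation that is functional in both directions is a matching; t0 is the
    irrelevant value of the function outside its domain. *)
Lemma matching_of_relation (S0 T0 : Type) (t0 : T0) (S : set S0) (T : set T0)
    (chi : set (S0 * T0)) :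
  (forall s t, chi (s, t) -> S s /\ T t) ->
  (forall s t t', chi (s, t) -> chi (s, t') -> t = t') ->
  (forall s s' t, chi (s, t) -> chi (s', t) -> s = s') ->
  matching S T chi.
Proof.
move=> chiST chif chiinj.
have /choice[f fP] s : exists t, forall t', chi (s, t') -> t' = t.
  have [[t st]|st] := pselect (exists t, chi (s, t)).
    by exists t => t' /chif; exact.
  by exists t0 => t' st'; case: st; exists t'.
exists [set s | exists t, chi (s, t)]%classic, [set t | exists s, chi (s, t)]%classic, f.
have fchi s : (exists t, chi (s, t)) -> chi (s, f s).
  by move=> [t st]; rewrite -(fP s t).
split=> [s [t /chiST[]]|t [s /chiST[]]|s /fchi|s s'|] //=.
- by exists s.
- by rewrite !inE /= => /fchi sc /fchi s'c ss'; apply: chiinj sc _; rewrite ss'.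
- apply/seteqP; split=> [[s t] st|_ [s /= /fchi sc <-]] //=.
  by exists s; [exists t|rewrite -(fP s t)].
Qed.

Theorem proposition5p6 (k : fieldType) (R : realType) (X : finMetricType R)
    (Y : {set X}) (delta : R) (hdelta : 0 <= delta)
    (hY : approximation delta Y) :
  interleaved (fun t => t) (fun t => t + delta)
    (rips_module k Y) (rips_module k [set: X]%SET)
  /\
  forall PDY PDX : set (dgm_point R),
    persistence_diagram (rips_module k Y) PDY ->
    persistence_diagram (rips_module k [set: X]%SET) PDX ->
    exists2 chi : set (dgm_point R * dgm_point R), matching PDY PDX chi &
      [/\ forall b d i b' d' i', chi ((b, d, i), (b', d', i')) ->
            (b - delta%:E <= b' <= b)%E /\ (d - delta%:E <= d' <= d)%E,
          forall b d i, unmatched_left PDY chi (b, d, i) ->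
            (d <= b + delta%:E)%E &
          forall b d i, unmatched_right PDX chi (b, d, i) ->
            (d <= b + delta%:E)%E].
Proof.
have /choice[r rP] x : exists y, y \in Y /\ mdist x y <= delta.
  by have [y] := hY x; exists y.
have inter := @rips_interleaved k R X Y delta r (fun x => (rP x).1)
  (fun x => (rP x).2) hdelta.
split=> // PDY PDX.
move=> /rips_diagram_basis[m [JY [p [[BY] JY1 JY0 [pD pinj psurj] pE]]]].
move=> /rips_diagram_basis[n [JX [q [[BX] JX1 JX0 [qD qinj qsurj] qE]]]].
have [M [Mclose Mfun Minj ML MR]] := barcode_matching BY BX
  (fun i => conj (JY1 i) (JY0 i)) (fun j => conj (JX1 j) (JX0 j))
  (lexx 0) hdelta (fun t => esym (addr0 t)) (fun t => erefl) inter.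
rewrite add0r in ML MR.
have {}pinj i i' : p i = p i' -> i = i' by apply: pinj; rewrite inE.
have {}qinj j j' : q j = q j' -> j = j' by apply: qinj; rewrite inE.
exists [set x | exists i j, M i j /\ x = (p i, q j)]%classic.
  apply: (matching_of_relation (0%E, 0%E, 0%N)) => [s t|s t t'|s s' t].
  - by move=> [i [j [_ [-> ->]]]]; split; [exact: pD|exact: qD].
  - move=> [i [j [ij [-> ->]]]] [i' [j' [ij' [/pinj ii' ->]]]].
    by subst i'; rewrite (Mfun _ _ _ ij ij').
  - move=> [i [j [ij [-> ->]]]] [i' [j' [ij' [-> /qinj jj']]]].
    by subst j'; rewrite (Minj _ _ _ ij ij').
split=> [b d l b' d' l' [i [j [ij [pi qj]]]]|b d l [Dp un]|b d l [Dq un]].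
- have [h1 h2 h3 h4] := Mclose _ _ ij; rewrite !adde0 in h1 h3.
  have [p1 p2] := pE i; have [q1 q2] := qE j.
  rewrite -pi /= in p1 p2; rewrite -qj /= in q1 q2.
  rewrite p1 p2 q1 q2 -/(itv_inf _) -/(itv_sup _) -/(itv_inf (JX j)) -/(itv_sup (JX j)).
  by rewrite !leeBlDr// h1 h2 h3 h4.
- have [i _ pi] := psurj _ Dp; have [p1 p2] := pE i.
  rewrite pi /= in p1 p2; rewrite p1 p2; apply: ML => j ij.
  by apply: (un (q j)); exists i, j; rewrite pi.
- have [j _ qj] := qsurj _ Dq; have [q1 q2] := qE j.
  rewrite qj /= in q1 q2; rewrite q1 q2; apply: MR => i ij.
  by apply: (un (p i)); exists i, j; rewrite qj.
Qed.
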